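(* Suppose $0<e_0=e_1\le e_2$. Then, denoting $(e_0,e_1,e_2)$ by $e$, we have $(w_0^{(n)}(e),w_1^{(n)}(e),w_2^{(n)}(e))\in\mathcal{C}$.
   Context: Here $n$ is a positive integer, and $V(\mathbb{T}_n)=(\mathbb{Z}/n\mathbb{Z})^2$ is the vertex set of the discrete torus obtained from the triangular lattice $\mathbb{Z}+\mathbb{Z}\omega$, $\omega=e^{2\pi i/3}$, modulo $n$ (with $1\mapsto(1,0)$, $\omega\mapsto(0,1)$). For $f:V(\mathbb{T}_n)\to\mathbb{R}$ the discrete Hessian on the three families $E_0,E_1,E_2$ of unit rhombi is given by $D_0f(a,b)=f(a,b)+f(a+2,b+1)-f(a+1,b)-f(a+1,b+1)$, $D_1f(a,b)=f(a+1,b)+f(a,b+1)-f(a,b)-f(a+1,b+1)$, $D_2f(a,b)=f(a,b)+f(a+1,b+2)-f(a+1,b+1)-f(a,b+1)$. For $s=(s_0,s_1,s_2)\in\mathbb{R}_{>0}^3$, $P_n(s)$ is the bounded convex polytope of all $g:V(\mathbb{T}_n)\to\mathbb{R}$ with $\sum_v g(v)=0$ and $D_rg(v)\le s_r$ for all $v$ and $r\in\{0,1,2\}$; $|P_n(s)|$ is its $(n^2-1)$-dimensional Lebesgue measure in the hyperplane of mean-zero functions. Put $w_i^{(n)}(s)=\frac1{n^2}\frac{\partial|P_n(s)|}{\partial s_i}$ for $i=0,1,2$. $\mathcal{C}$ is the open cone of points $(u_0,u_1,u_2)\in\mathbb{R}_{>0}^3$ with $\min_\sigma\left(u_{\sigma(0)}+u_{\sigma(1)}-u_{\sigma(2)}\right)>0$,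 $\sigma$ ranging over all permutations of $\{0,1,2\}$.
   Formalization: The formal theorem takes n ≥ 2 instead of every positive integer n: for n = 1 all discrete Hessians vanish, P_1(s) = {0} has constant volume, so w = (0,0,0), which is not in the open cone C. *)

(* Defs.v *)
From HB Require Import structures.
From mathcomp Require Import all_boot all_order all_algebra all_fingroup.
From mathcomp Require Import all_classical all_reals all_analysis.

Set Implicit Arguments.
Unset Strict Implicit.
Unset Printing Implicit Defensive.
Import Order.TTheory GRing.Theory Num.Theory.
Import numFieldNormedType.Exports.
Local Open Scope classical_set_scope.
Local Open Scope ring_scope.

(* Lebesgue measure on R^d as an iterated integral. Each step is the product
   measure [lebesgue_measure \x _], transported along (x, t) |-> x :: t. *)
Fixpoint lebesgue_tuple {R : realType} (d : nat) :
    set (d.-tuple R) -> \bar R :=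
  match d return set (d.-tuple R) -> \bar R with
  | 0%N => fun A => dirac [tuple] A
  | d'.+1 => fun A =>
      (\int[@lebesgue_measure R]_x
         lebesgue_tuple [set t : d'.-tuple R | A [tuple of (x : R) :: t]])%E
  end.

(* Lebesgue measure on the Euclidean space R^T, for a finite index set T. *)
Definition lebesgue_fun {R : realType} {T : finType} (A : set (T -> R)) :
    \bar R :=
  @lebesgue_tuple R #|T| [set t | A (fun v => tnth t (enum_rank v))].

(* (#|T| - 1)-dimensional Lebesgue measure of a subset A of the hyperplane of
   mean-zero functions on T, with respect to the induced Euclidean structure:
   the measure in R^T of the orthogonal cylinder of height 1 over A. The
   constant function 1 / sqrt #|T| is a unit normal to the hyperplane. *)
Definition lebesgue_mean0 {R : realType} {T : finType} (A : set (T -> R)) :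
    \bar R :=
  lebesgue_fun [set (fun v => g v + h / Num.sqrt #|T|%:R)
               | g in A & h in `[0, 1]].

(* Vertices of the discrete torus. As 'Z_1 is Z/2Z, this is only meaningful
   for n > 1. *)
Definition torus (n : nat) : finType := ('Z_n * 'Z_n)%type.

Section Hessian.
Variables (R : realType) (n : nat).
Implicit Types (f : torus n -> R) (v : torus n).

Definition hess0 f v : R := let: (a, b) := v in
  f (a, b) + f (a + 2, b + 1) - f (a + 1, b) - f (a + 1, b + 1).

Definition hess1 f v : R := let: (a, b) := v in
  f (a + 1, b) + f (a, b + 1) - f (a, b) - f (a + 1, b + 1).

Definition hess2 f v : R := let: (a, b) := v in
  f (a, b) + f (a + 1, b + 2) - f (a + 1, b + 1) - f (a, b + 1).

Definition hess (r : 'I_3) : (torus n -> R) -> torus n -> R :=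
  tnth [tuple hess0; hess1; hess2] r.

Definition polytope (s : 'rV[R]_3) : set (torus n -> R) :=
  [set g | \sum_v g v = 0 /\ forall v r, hess r g v <= s 0 r].

Definition volume (s : 'rV[R]_3) : R := fine (lebesgue_mean0 (polytope s)).

(* The partial derivative is the directional derivative along the i-th basis
   vector. The library gives it the value 0 where it does not exist. *)
Definition w (s : 'rV[R]_3) (i : 'I_3) : R :=
  (n ^ 2)%:R^-1 * 'D_(delta_mx 0 i) volume s.

End Hessian.

Definition cone {R : realType} : set 'rV[R]_3 :=
  [set u | (forall i, 0 < u 0 i) /\
    let F (sigma : 'S_3) := u 0 (sigma 0) + u 0 (sigma 1) - u 0 (sigma 2) in
    0 < \big[Num.min/F 1%g]_(sigma : 'S_3) F sigma].

(* Main.v *)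
From HB Require Import structures.
Require Import Defs.
From mathcomp Require Import all_boot all_order all_algebra fingroup perm.
From mathcomp Require Import all_classical all_reals all_analysis.
From mathcomp Require Import measurable_realfun ring lra.

(** Write [N] for the number of vertices of the torus, [D_r x] for the three
Hessians of a function [x] on it and [V(s)] for the volume of the polytope.
Cylinders of height 1 along the constants are, after rescaling, sets of
functions with a bounded sum: [V(s)] is the [N]-dimensional measure of the
prism [{x : D_r x <= s_r, 0 <= sum x <= sqrt N}] (lemma [volumeE]).

Two reflections of the triangular lattice exchange [D_0] with [D_1] and [D_0]
with [D_2], so [V] is a symmetric function of [s] ([volume_swap01],
[volume_swap02]). As [e_0 = e_1], this gives [w_0 = w_1], and the claim becomes
[0 < w_2 <= w_0]. As [w] is 0 by convention where [V] has no derivative, the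
existence of the partial derivatives is part of the problem.

Existence and positivity ([volume_derivative2]). Let [p] and [q] be the gauges
of the constraints on [D_2] and on [D_0, D_1], so that the prism of [s] is
[p <= 1, q <= 1] and raising [s_2] by a factor [r] gives [p <= r, q <= 1].
What is gained lies in the shell between the prism and its dilation by [r],
and up to the difference between the cones [p >= q] and [p >= r q] it is the
part of this shell in the cone [p >= q]. Dilating a cone by [r] multiplies its
measure, at fixed height, by [r ^ (N - 1)]; hence the derivative is a multiple
of the measure [k] of the part of the prism where [p >= q], provided that the
set [p = q] is null. This set lies in finitely many hyperplanes
[D_2 x v / s_2 = D_r x v' / s_r], and these are proper: a function of the second
coordinate alone has [D_0 = D_1 = 0], but [D_2] does not vanish on it. The same
functions provide an interior point of [p > q], whence [k > 0].

The inequality [w_2 <= w_0] ([volume_schur]). Let [h > 0] and let [s] be [e]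
with [h] added to its third entry. As [e_0 <= e_2], the vector [e] with [h]
added to its first entry is a convex combination of [s] and of its reflection
[s'], which have the same volume. The prism of a convex combination contains
the convex combination of the prisms, so the Brunn-Minkowski inequality bounds
its volume below by the common volume; divide by [h].

The inequality is proved in its multiplicative form [brunn_minkowski], by
induction on the dimension. The step is the one-dimensional theorem of
Prekopa and Leindler for the volumes of the slices. The induction hypothesis
makes these quasi-concave, so that only superlevel sets that are intervals
occur, for which the one-dimensional Brunn-Minkowski inequality is elementary.

All invariance properties of the iterated integral [lebesgue_tuple] come from
one fact: it is a measure determined by its values on boxes. *)

Set Implicit Arguments.
Unset Strict Implicit.
Unset Printing Implicit Defensive.
Import Order.TTheory GRing.Theory Num.Theory.
Import numFieldNormedType.Exports.
Local Open Scope classical_set_scope.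
Local Open Scope ring_scope.

(** * The iterated Lebesgue integral as a measure *)

Lemma subset_measure d (T : measurableType d) (R : realType)
    (m : {measure set T -> \bar R}) (A B : set T) :
  measurable A -> measurable B -> A `<=` B -> (m A <= m B)%E.
Proof. by move=> mA mB; apply: le_measure; rewrite inE. Qed.

(** The pushforward as a bundled measure; the structure depends on the proof of
measurability, hence the explicit argument. *)
Definition image_measure d1 d2 (T1 : measurableType d1) (T2 : measurableType d2)
    (R : realType) (m : {measure set T1 -> \bar R}) (f : T1 -> T2)
    (mf : measurable_fun [set: T1] f) : {measure set T2 -> \bar R} :=
  measure_function_pushforward__canonical__measure_function_Measure m mf.

Section cons_measure.
Variables (R : realType) (d : nat).
Variable m : {sigma_finite_measure set (d.-tuple R) -> \bar R}.

(* [lebesgue_measure] lives on this copy of [R], which has the same measurable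
   sets as [R] but another display. *)
Local Notation GR := (measurableTypeR R).

Definition consp (p : GR * d.-tuple R) : d.+1.-tuple R := [tuple of p.1 :: p.2].

Definition uncons (t : d.+1.-tuple R) : GR * d.-tuple R :=
  (thead t, [tuple of behead t]).

Lemma measurable_consp : measurable_fun [set: GR * d.-tuple R] consp.
Proof.
apply: (@measurable_cons _ _ (GR * d.-tuple R)%type R fst d snd).
  move=> _ Y mY; exact: (@measurable_fst _ _ GR (d.-tuple R) measurableT Y mY).
exact: measurable_snd.
Qed.

Lemma measurable_uncons : measurable_fun [set: d.+1.-tuple R] uncons.
Proof.
apply: measurable_fun_pair; last exact: measurable_behead.
move=> _ Y mY; exact: (@measurable_tnth _ R d.+1 ord0 measurableT Y mY).
Qed.

Lemma conspK : cancel consp uncons.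
Proof.
by move=> [x t]; rewrite /uncons /consp theadE; congr pair; apply/val_inj.
Qed.

Definition cons_measure : set (d.+1.-tuple R) -> \bar R :=
  pushforward ((@lebesgue_measure R) \x m)%E consp.

HB.instance Definition _ := Measure.copy cons_measure
  (image_measure ((@lebesgue_measure R) \x m)%E measurable_consp).

Let cons_measure_sigma_finite : sigma_finite [set: d.+1.-tuple R] cons_measure.
Proof.
have /sigma_finiteP[F [TF ndF Foo]] := sigma_finiteT (@lebesgue_measure R).
have /sigma_finiteP[G [TG ndG Goo]] := sigma_finiteT m.
exists (fun k => uncons @^-1` (F k `*` G k)).
  rewrite -preimage_bigcup -[LHS](preimage_setT uncons); congr (_ @^-1` _).
  rewrite -setXTT TF TG predeqE => -[x y]; split.
    move=> [/= [n _ Fnx] [k _ Gky]]; exists (maxn n k) => //; split.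
    - by move: x Fnx; exact/subsetPset/ndF/leq_maxl.
    - by move: y Gky; exact/subsetPset/ndG/leq_maxr.
  by move=> [n _ []/= ? ?]; split; exists n.
move=> k; have [mF Fk] := Foo k; have [mG Gk] := Goo k; split.
  rewrite -[X in measurable X]setTI.
  by apply: measurable_uncons => //; exact: measurableX.
rewrite /cons_measure /pushforward -comp_preimage.
rewrite (_ : uncons \o consp = id) ?preimage_id//; last exact/funext/conspK.
by rewrite product_measure1E// lte_mul_pinfty// ge0_fin_numE.
Qed.

HB.instance Definition _ := Measure_isSigmaFinite.Build _ _ _ cons_measure
  cons_measure_sigma_finite.

Lemma cons_measureE A :
  cons_measure A = (\int[@lebesgue_measure R]_x 
     m [set t : d.-tuple R | A [tuple of (x : R) :: t]])%E.
Proof.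
rewrite /cons_measure /pushforward /product_measure1 /=.
by apply: eq_integral => x _; congr (m _); apply/seteqP; split=> t /=;
  rewrite /xsection/= inE.
Qed.

End cons_measure.

Section tuple_measure.
Variable R : realType.
Local Notation mu := (@lebesgue_measure R).
Local Notation lam := (@lebesgue_tuple R).

(** The equality holds on all sets, measurable or not: the product measure of
a set is by definition the integral of the measures of its sections. *)
Lemma lebesgue_tuple_sigma_finite d :
  {m : {sigma_finite_measure set (d.-tuple R) -> \bar R} |
     (m : set (d.-tuple R) -> \bar R) = @lebesgue_tuple R d}.
Proof.
elim: d => [|d [m mE]].
  by exists (\d_([tuple] : 0.-tuple R))%R.
exists (cons_measure m); apply/funext => A.
by rewrite -[LHS]/(cons_measure m A) cons_measureE /= mE.
Qed.

Section measure_instance.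
Variable d : nat.
Let m := proj1_sig (lebesgue_tuple_sigma_finite d).
Let mE : (m : set (d.-tuple R) -> \bar R) = @lebesgue_tuple R d.
Proof. exact: (proj2_sig (lebesgue_tuple_sigma_finite d)). Qed.

Let lam0 : @lebesgue_tuple R d set0 = 0%E. Proof. by rewrite -mE measure0. Qed.
Let lam_ge0 (A : set (d.-tuple R)) : (0 <= lam A)%E.
Proof. by rewrite -mE measure_ge0. Qed.
Let lam_sigma : semi_sigma_additive (@lebesgue_tuple R d).
Proof. by rewrite -mE; exact: measure_semi_sigma_additive. Qed.
Let lam_sf : sigma_finite setT (@lebesgue_tuple R d).
Proof. by rewrite -mE; exact: sigma_finiteT. Qed.

HB.instance Definition _ := isMeasure.Build _ _ _ (@lebesgue_tuple R d)
  lam0 lam_ge0 lam_sigma.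
HB.instance Definition _ := Measure_isSigmaFinite.Build _ _ _
  (@lebesgue_tuple R d) lam_sf.
End measure_instance.

Lemma lebesgue_tupleS d (A : set (d.+1.-tuple R)) :
  lam A = ((@lebesgue_measure R) \x (@lebesgue_tuple R d))%E (@consp R d @^-1` A).
Proof. by rewrite /= -(cons_measureE (@lebesgue_tuple R d) A). Qed.

Lemma measurable_consl d (A : set (d.+1.-tuple R)) x :
  measurable A -> measurable [set t : d.-tuple R | A [tuple of x :: t]].
Proof.
move=> mA; have mc : measurable_fun [set: d.-tuple R]
    (fun t => [tuple of x :: t] : d.+1.-tuple R).
  by apply: measurable_cons; [exact: measurable_cst|exact: measurable_id].
by rewrite -[X in measurable X]setTI; exact: mc.
Qed.

Lemma measurable_section d (A : set (d.+1.-tuple R)) : measurable A ->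
  measurable_fun [set: R]
    (fun x : R => lam [set t : d.-tuple R | A [tuple of x :: t]]).
Proof.
move=> mA.
have mA' : measurable (@consp R d @^-1` A).
  by rewrite -[X in measurable X]setTI; exact: measurable_consp.
have := measurable_fun_xsection (@lebesgue_tuple R d) mA'.
apply: eq_measurable_fun => x _ /=; congr (lam _).
by apply/seteqP; split=> t /=; rewrite /xsection/= inE.
Qed.

Definition box d (X : 'I_d -> set R) : set (d.-tuple R) :=
  [set t | forall i, X i (tnth t i)].

Lemma measurable_tnth_preimage d (i : 'I_d) (Y : set R) : measurable Y ->
  measurable [set t : d.-tuple R | Y (tnth t i)].
Proof.
by move=> mY; rewrite -[X in measurable X]setTI; exact: measurable_tnth.
Qed.

Lemma measurable_box d (X : 'I_d -> set R) :
  (forall i, measurable (X i)) -> measurable (box X).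
Proof.
move=> mX; rewrite (_ : box X =
    \bigcap_(i in [set: 'I_d]) [set t : d.-tuple R | X i (tnth t i)]).
  by apply: fin_bigcap_measurable => // i _; exact: measurable_tnth_preimage.
by apply/seteqP; split => [t Xt i _ /=|t Xt i]; exact: Xt.
Qed.

Lemma lebesgue_box d (X : 'I_d -> set R) : (forall i, measurable (X i)) ->
  lam (box X) = (\prod_(i < d) mu (X i))%E.
Proof.
elim: d X => [|d IH] X mX.
  rewrite big_ord0 /= diracE mem_set//; by case.
rewrite lebesgue_tupleS big_ord_recl -IH; last by move=> i; exact: mX.
rewrite -product_measure1E; [|exact: mX|exact: measurable_box].
congr (_ _); apply/seteqP; split=> [[x t] /= H|[x t] /= [H0 H] i].
  split; first by have := H ord0; rewrite tnth0.
  by move=> i; have := H (lift ord0 i); rewrite tnthS.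
by case: (unliftP ord0 i) => [j|] ->; rewrite ?tnthS ?tnth0//; exact: H.
Qed.

Lemma measurable_tuple_boxes d : (measurable : set (set (d.-tuple R))) =
  <<s [set box X | X in [set X : 'I_d -> set R | forall i, measurable (X i)]] >>.
Proof.
apply/seteqP; split; last first.
  apply: smallest_sub; first exact: sigma_algebra_measurable.
  by move=> _ [X mX <-]; exact: measurable_box.
apply: smallest_sub; first exact: smallest_sigma_algebra.
move=> A; rewrite -bigcup_seq => -[i /= _ [Y mY <-]].
apply: sub_sigma_algebra; exists (fun j => if j == i then Y else setT).
  by move=> j /=; case: ifP.
rewrite setTI; apply/seteqP; split => [t /(_ i)/=|t /= Yt j]; first by rewrite eqxx.
by case: ifPn => // /eqP ->.
Qed.

(** Boxes form a pi-system that generates the product sigma-algebra, and the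
cubes of side [2 k] exhaust the space. *)
Lemma lebesgue_tuple_unique d (m : {measure set (d.-tuple R) -> \bar R}) :
  (forall X : 'I_d -> set R, (forall i, measurable (X i)) ->
     m (box X) = (\prod_(i < d) mu (X i))%E) ->
  forall A, measurable A -> m A = lam A.
Proof.
move=> mbox A mA; apply/esym.
apply: (measure_unique [set box X | X in
    [set X : 'I_d -> set R | forall i, measurable (X i)]]
  (fun k => box (fun=> `]- k%:R, k%:R[%classic))) => //.
- exact: measurable_tuple_boxes.
- move=> _ _ [X mX <-] [Y mY <-]; exists (fun i => X i `&` Y i).
    by move=> i; exact: measurableI.
  apply/seteqP; split=> t; last by case=> Xt Yt i; split.
  by move=> XY; split=> i; case: (XY i).
- by move=> k; exists (fun=> `]- k%:R, k%:R[%classic).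
- apply/seteqP; split=> // t _.
  pose M := \sum_(i < d) `|tnth t i|.
  have [k kM] : exists k : nat, M < k%:R.
    by exists (Num.truncn M).+1; rewrite truncnS_gt.
  exists k => // i /=; rewrite in_itv/= -ltr_norml (le_lt_trans _ kM)//.
  by rewrite /M (bigD1 i)//= lerDl sumr_ge0.
- by move=> _ [X mX <-]; rewrite mbox//; exact: lebesgue_box.
- move=> k; rewrite [X in (X < _)%E]lebesgue_box//.
  rewrite ltey_eq prode_fin_num// => i _.
  by rewrite lebesgue_measure_itv/=; case: ifP.
Qed.

End tuple_measure.

(** ** Invariance, hyperplanes and open boxes *)

Section tuple_invariance.
Variable R : realType.
Local Notation mu := (@lebesgue_measure R).
Local Notation lam := (@lebesgue_tuple R).

Lemma lebesgue_measure_affine (a b : R) (X : set R) : 0 < a -> measurable X ->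
  mu [set x | X (a * x + b)] = (a^-1%:E * mu X)%E.
Proof.
move=> a0 mX; pose f := fun x : measurableTypeR R => a * x + b : measurableTypeR R.
have mf : measurable_fun [set: measurableTypeR R] f.
  by apply: measurable_funD => //; exact: measurable_funM.
have an : 0 <= a by exact: ltW.
have h : mu X = (a%:E * mu [set x : R | X (a * x + b)%R])%E.
  pose m := mscale (NngNum an) (image_measure mu mf).
  have := @lebesgue_measure_unique R m; apply => //= _ [[u v] _ <-].
  rewrite /m /mscale /= /pushforward.
  have -> : f @^-1` `]u, v] = `](u - b) / a, (v - b) / a]%classic.
    apply/seteqP; split=> x /=; rewrite !in_itv/= /f => /andP[h1 h2]; apply/andP; split.
    - by rewrite ltr_pdivrMr// mulrC; lra.
    - by rewrite ler_pdivlMr// mulrC; lra.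
    - by move: h1; rewrite ltr_pdivrMr// mulrC; lra.
    - by move: h2; rewrite ler_pdivlMr// mulrC; lra.
  rewrite !lebesgue_measure_itv/= !lte_fin ltr_pM2r ?invr_gt0// ltrD2r.
  case: ifP => _; last by rewrite mule0.
  rewrite -!EFinD -EFinM; congr (_%:E); field; lra.
by rewrite h muleA -EFinM mulVf ?gt_eqF// mul1e.
Qed.

Definition tmap d (f : R -> R) (t : d.-tuple R) : d.-tuple R := [tuple of map f t].

Lemma lebesgue_tuple_affine d (a b : R) (A : set (d.-tuple R)) :
  0 < a -> measurable A ->
  lam [set t | A (tmap (fun x => a * x + b) t)] = ((a^-1 ^+ d)%:E * lam A)%E.
Proof.
move=> a0 mA; pose f := fun t : d.-tuple R => tmap (fun x => a * x + b) t.
have mf : measurable_fun [set: d.-tuple R] f.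
  apply/measurable_fun_tnthP => i.
  rewrite (_ : _ \o _ = fun t => a * tnth t i + b); last first.
    by apply/funext => t /=; rewrite tnth_map.
  apply: measurable_funD => //; apply: measurable_funM => //.
  exact: measurable_tnth.
have an : 0 <= a ^+ d by rewrite exprn_ge0// ltW.
pose m := mscale (NngNum an) (image_measure (@lebesgue_tuple R d) mf).
have h : m A = lam A.
  apply: (@lebesgue_tuple_unique R d m) => // X mX.
  rewrite -[LHS]/((a ^+ d)%:E * lam (f @^-1` box X))%E.
  have -> : f @^-1` box X = box (fun i => [set x | X i (a * x + b)]).
    by apply/seteqP; split=> t /= H i; have := H i; rewrite /= tnth_map.
  rewrite lebesgue_box; last first.
    move=> i; rewrite -[X in measurable X]setTI.
    have mg : measurable_fun [set: R] (fun x : R => a * x + b).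
      by apply: measurable_funD => //; exact: measurable_funM.
    exact: mg.
  under eq_bigr do rewrite lebesgue_measure_affine//.
  rewrite big_split /= prodEFin prodr_const card_ord muleA -EFinM.
  by rewrite -exprMn divff ?gt_eqF// expr1n mul1e.
rewrite -h -[m A]/((a ^+ d)%:E * lam (f @^-1` A))%E muleA -EFinM -exprMn mulVf ?gt_eqF//.
by rewrite expr1n mul1e.
Qed.

Definition tperm_of d (s : 'S_d) (t : d.-tuple R) : d.-tuple R :=
  [tuple tnth t (s i) | i < d].

Lemma lebesgue_tuple_perm d (s : 'S_d) (A : set (d.-tuple R)) : measurable A ->
  lam [set t | A (tperm_of s t)] = lam A.
Proof.
move=> mA; pose f := fun t : d.-tuple R => tperm_of s t.
have mf : measurable_fun [set: d.-tuple R] f.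
  apply/measurable_fun_tnthP => i.
  rewrite (_ : _ \o _ = fun t => tnth t (s i)); first exact: measurable_tnth.
  by apply/funext => t /=; rewrite tnth_mktuple.
pose m := image_measure (@lebesgue_tuple R d) mf.
apply: (@lebesgue_tuple_unique R d m) => // X mX.
rewrite -[LHS]/(lam (f @^-1` box X)).
have -> : f @^-1` box X = box (fun i => X (s^-1 i)%g).
  apply/seteqP; split=> t /= H i; first by have := H (s^-1 i)%g; rewrite tnth_mktuple permKV.
  by have := H (s i); rewrite permK tnth_mktuple.
rewrite lebesgue_box// [RHS](reindex_inj (@perm_inj _ (s^-1)%g)).
by [].
Qed.

(** If some coefficient beyond the first is nonzero, every section is a proper
hyperplane; otherwise all sections but one are empty. *)
Lemma lebesgue_hyperplane d (c : 'I_d -> R) (b : R) : (exists i, c i != 0) ->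
  lam [set t | \sum_(i < d) c i * tnth t i = b] = 0%E.
Proof.
elim: d c b => [|d IH] c b [i ci]; first by case: i ci.
pose S x := [set t : d.-tuple R |
    \sum_(i < d) c (lift ord0 i) * tnth t i = b - c ord0 * x].
have E (x : R) : [set t : d.-tuple R |
    \sum_(i < d.+1) c i * tnth [tuple of x :: t] i = b] = S x.
  apply/seteqP; split=> t /=; rewrite big_ord_recl tnth0 /S /=.
    by move=> <-; rewrite addrC addKr; apply: eq_bigr => j _; rewrite tnthS.
  under [in X in _ -> X]eq_bigr do rewrite tnthS.
  by move=> ->; rewrite addrC subrK.
rewrite /=; under eq_integral => x _.
  rewrite E; over.
have [[j cj]|cN] := pselect (exists j, c (lift ord0 j) != 0).
  by apply: integral0_eq => x _; apply: IH; exists j.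
have {}cN j : c (lift ord0 j) = 0.
  by apply/eqP/negPn/negP => cj; apply: cN; exists j.
have c0 : c ord0 != 0.
  by case: (unliftP ord0 i) ci => [j ->|->//]; rewrite cN eqxx.
rewrite -[RHS](integral_set1 (fun x => lam (S x)) (b / c ord0)) [RHS]integral_mkcond.
apply: eq_integral => x _; rewrite patchE; case: ifPn => // /negP xb.
rewrite (_ : S x = set0) ?measure0// -subset0 => t; rewrite /S /=.
rewrite big1 => [h|j _]; last by rewrite cN mul0r.
apply: xb; rewrite inE/=; apply: (mulIf c0); rewrite divfK//.
by apply/esym/eqP; rewrite -subr_eq0 mulrC -h.
Qed.

Lemma lebesgue_open_box d (c : 'I_d -> R) (r : R) : 0 < r ->
  (0 < lam (box (fun i => [set` `]c i - r, c i + r[%R])))%E.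
Proof.
move=> r0; rewrite lebesgue_box//.
under eq_bigr => i _.
  rewrite lebesgue_measure_itv/= lte_fin ltrD2l gtrN//.
  rewrite -EFinD (_ : _ - _ = 2 * r); last by ring.
  over.
by rewrite prodEFin lte_fin prodr_gt0// => i _; rewrite mulr_gt0.
Qed.

End tuple_invariance.

(** * The Prekopa-Leindler inequality on the line *)

Section prekopa_leindler.
Variable R : realType.
Local Notation mu := (@lebesgue_measure R).

Lemma lebesgue_measure_below (e : \bar R) : (0 <= e)%E ->
  mu [set t : R | 0 <= t%:E < e]%E = e.
Proof.
case: e => [r||]// r0.
  rewrite (_ : [set t | _] = `[0%R, r[%classic); last first.
    by apply/seteqP; split=> t /=; rewrite in_itv/= !lee_fin lte_fin.
  rewrite lebesgue_measure_itv/= lte_fin oppr0 adde0.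
  by move: r0; rewrite lee_fin le_eqVlt => /orP[/eqP <-|->//]; rewrite ltxx.
rewrite (_ : [set t | _] = `[0%R, +oo[%classic); last first.
  by apply/seteqP; split=> t /=; rewrite in_itv/= !lee_fin ?ltry.
by rewrite lebesgue_measure_itv/= ltry.
Qed.

(** Tonelli's theorem for the region below the graph of [f]. *)
Lemma layer_cake (f : R -> \bar R) : measurable_fun [set: R] f ->
  (forall x, 0 <= f x)%E ->
  (\int[mu]_x f x = \int[mu]_(t in `[0%R, +oo[) mu [set x : R | (t : R)%:E < f x])%E.
Proof.
move=> mf f0; pose GR := measurableTypeR R.
pose E := [set p : GR * GR | (0 <= (p.2 : R)%:E)%E] `&`
          [set p : GR * GR | ((p.2 : R)%:E < f p.1)%E].
have m2 : measurable_fun [set: GR * GR] (fun p : GR * GR => (p.2 : R)%:E).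
  by apply/measurable_EFinP; exact: measurable_snd.
have m1 : measurable_fun [set: GR * GR] (fun p : GR * GR => f p.1).
  apply: (@measurableT_comp _ _ _ _ _ _ (f : GR -> \bar R)) => //.
have mE : measurable E.
  apply: measurableI; rewrite -[X in measurable X]setTI.
    exact: emeasurable_fun_le.
  exact: emeasurable_fun_lt.
have := @indic_fubini_tonelli _ _ GR GR R mu mu E mE.
rewrite (indic_fubini_tonelli_FE mu mE) (indic_fubini_tonelli_GE mu mE) => H.
transitivity (\int[mu]_x mu (xsection E x))%E.
  apply: eq_integral => x _.
  rewrite (_ : xsection E x = [set t : R | 0 <= t%:E < f x]%E); last first.
    apply/seteqP; split=> t; rewrite /xsection/= inE /E/=; first by case=> -> ->.
    by move=> /andP h; exact: h.
  by rewrite lebesgue_measure_below.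
rewrite H [RHS]integral_mkcond; apply: eq_integral => t _; rewrite patchE.
case: ifPn => [/set_mem|/negP]; rewrite ?inE/= in_itv/= andbT => t0.
  rewrite /=; congr (mu _); apply/seteqP; split=> x.
    by rewrite /ysection/= inE /E/= lee_fin => -[].
  by rewrite /ysection/= inE /E/= lee_fin => h; split.
have -> : ysection E t = set0; last by rewrite /= measure0.
rewrite -subset0 => x; rewrite /ysection/= inE /E/= lee_fin => -[/t0].
by [].
Qed.

Lemma is_interval_segment (F : set R) x y t : is_interval F -> F x -> F y ->
  0 <= t <= 1 -> F (x + t * (y - x)).
Proof.
move=> iF Fx Fy /andP[t0 t1]; have [xy|yx] := leP x y.
  by apply: (iF x y) => //; apply/andP; split; nra.
by apply: (iF y x) => //; apply/andP; split; nra.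
Qed.

Lemma le_measure_itv_inf_sup (F : set R) : measurable F -> F !=set0 ->
  has_lbound F -> has_ubound F -> (mu F <= (sup F - inf F)%:E)%E.
Proof.
move=> mF F0 lF uF; have [x Fx] := F0.
have ab : inf F <= sup F.
  by rewrite (le_trans (ge_inf lF Fx))//; exact: ub_le_sup.
apply: (@le_trans _ _ (mu `[inf F, sup F])).
  apply: subset_measure => //.
  by move=> y Fy /=; rewrite in_itv/= ge_inf//= ub_le_sup.
by rewrite lebesgue_measure_itv/= lte_fin; case: ifP => // _; rewrite lee_fin subr_ge0.
Qed.

(** A point strictly between the combined infima and suprema of [F] and [G] is
between two combinations of points of [F] and [G]; moving both points at the
same speed from one combination to the other, one passes through it. *)
Lemma brunn_minkowski_interval (F G H : set R) (l : R) : 0 < l < 1 ->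
  measurable F -> measurable G -> measurable H ->
  F !=set0 -> G !=set0 -> is_interval F -> is_interval G ->
  has_lbound F -> has_ubound F -> has_lbound G -> has_ubound G ->
  (forall x y, F x -> G y -> H ((1 - l) * x + l * y)) ->
  ((1 - l)%:E * mu F + l%:E * mu G <= mu H)%E.
Proof.
move=> /andP[l0 l1] mF mG mH F0 G0 iF iG lF uF lG uG FGH.
pose u := (1 - l) * inf F + l * inf G; pose v := (1 - l) * sup F + l * sup G.
have sub : `]u, v[ `<=` H.
  move=> z /=; rewrite in_itv/= => /andP[uz zv].
  have [x0 Fx0 x0z] := @inf_adherent _ F (z - u) ltac:(lra) (conj F0 lF).
  have [y0 Gy0 y0z] := @inf_adherent _ G (z - u) ltac:(lra) (conj G0 lG).
  have [x1 Fx1 x1z] := @sup_adherent _ F (v - z) ltac:(lra) (conj F0 uF).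
  have [y1 Gy1 y1z] := @sup_adherent _ G (v - z) ltac:(lra) (conj G0 uG).
  pose p0 := (1 - l) * x0 + l * y0; pose p1 := (1 - l) * x1 + l * y1.
  have p0z : p0 < z by rewrite /p0; rewrite /u in x0z y0z uz; nra.
  have p1z : z < p1 by rewrite /p1; rewrite /v in x1z y1z zv; nra.
  pose t := (z - p0) / (p1 - p0).
  have p01 : 0 < p1 - p0 by lra.
  have t01 : 0 <= t <= 1.
    by rewrite /t divr_ge0 ?ler_pdivrMr//=; lra.
  have := FGH _ _ (is_interval_segment iF Fx0 Fx1 t01)
                  (is_interval_segment iG Gy0 Gy1 t01).
  have -> // : (1 - l) * (x0 + t * (x1 - x0)) + l * (y0 + t * (y1 - y0)) = z.
  transitivity (p0 + t * (p1 - p0)); first by rewrite /p0 /p1; ring.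
  by rewrite /t divfK ?gt_eqF//; lra.
have hF := le_measure_itv_inf_sup mF F0 lF uF.
have hG := le_measure_itv_inf_sup mG G0 lG uG.
apply: (@le_trans _ _ ((1 - l)%:E * (sup F - inf F)%:E + l%:E * (sup G - inf G)%:E)%E).
  by apply: leeD; apply: lee_pmul => //; rewrite lee_fin; lra.
rewrite -!EFinM -EFinD.
have -> : (1 - l) * (sup F - inf F) + l * (sup G - inf G) = v - u.
  by rewrite /u /v; ring.
have [uv|vu] := ltP u v; last first.
  by apply: (@le_trans _ _ 0%E); rewrite ?measure_ge0// lee_fin; lra.
rewrite (_ : (v - u)%:E = mu `]u, v[); last by rewrite lebesgue_measure_itv/= lte_fin uv.
by apply: subset_measure => //.
Qed.

Lemma measurable_distribution (f : R -> \bar R) : measurable_fun [set: R] f ->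
  measurable_fun [set: R] (fun t : R => mu [set x : R | (t%:E < f x)%E]).
Proof.
move=> mf; pose GR := measurableTypeR R.
pose E := [set p : GR * GR | ((p.2 : R)%:E < f p.1)%E].
have mE : measurable E.
  rewrite -[X in measurable X]setTI; apply: emeasurable_fun_lt => //.
    by apply/measurable_EFinP; exact: measurable_snd.
  by apply: (@measurableT_comp _ _ _ _ _ _ (f : GR -> \bar R)).
have := @measurable_fun_ysection _ _ GR GR R mu E mE.
have -> // : mu \o ysection E = fun t : R => mu [set x : R | (t%:E < f x)%E].
apply/funext => t; rewrite /comp; congr (mu _).
by apply/seteqP; split=> x; rewrite /ysection/= inE.
Qed.

(** When [f] and [g] both have supremum 1, their superlevel sets are nonempty
for the same levels, so the inequality for intervals applies level by level. *)
Lemma prekopa_leindler_normalized (f g h : R -> \bar R) (K l : R) : 0 < l < 1 ->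
  measurable_fun setT f -> measurable_fun setT g -> measurable_fun setT h ->
  (forall x, 0 <= f x <= 1)%E -> (forall x, 0 <= g x <= 1)%E ->
  (forall x, 0 <= h x)%E ->
  (forall t : R, 0 <= t < 1 -> [set x | t%:E < f x]%E !=set0) ->
  (forall t : R, 0 <= t < 1 -> [set x | t%:E < g x]%E !=set0) ->
  (forall t : R, 0 <= t -> is_interval [set x | t%:E < f x]%E) ->
  (forall t : R, 0 <= t -> is_interval [set x | t%:E < g x]%E) ->
  (forall x, (0 < f x)%E -> `|x| <= K) -> (forall x, (0 < g x)%E -> `|x| <= K) ->
  (forall t x y : R, 0 <= t -> (t%:E < f x)%E -> (t%:E < g y)%E ->
     (t%:E < h ((1 - l) * x + l * y)%R)%E) ->
  ((1 - l)%:E * (\int[mu]_x f x) + l%:E * (\int[mu]_x g x) <= \int[mu]_x h x)%E.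
Proof.
move=> /[dup] l01 /andP[l0 l1] mf mg mh f01 g01 h0 f1 g1 cf cg sf sg fgh.
have f0 x : (0 <= f x)%E by case/andP: (f01 x).
have g0 x : (0 <= g x)%E by case/andP: (g01 x).
rewrite (layer_cake mf f0) (layer_cake mg g0) (layer_cake mh h0).
have mt (u : R -> \bar R) (t : R) : measurable_fun setT u ->
    measurable [set x | t%:E < u x]%E.
  by move=> mu'; rewrite -[X in measurable X]setTI; exact: emeasurable_fun_lt.
have md (u : R -> \bar R) : measurable_fun setT u ->
    measurable_fun (`[0, +oo[%classic : set R) (fun t : R => mu [set x : R | (t%:E < u x)%E]).
  by move=> /measurable_distribution; exact: measurable_funS.
have bl (u : R -> \bar R) (t : R) : (forall x, (0 < u x)%E -> `|x| <= K) -> 0 <= t ->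
    has_lbound [set x | t%:E < u x]%E /\ has_ubound [set x | t%:E < u x]%E.
  by move=> su t0; split; [exists (- K)|exists K] => x /= tu;
    have /ler_normlP[] : `|x| <= K by [apply: su; exact: le_lt_trans tu|]; lra.
rewrite -!ge0_integralZl_EFin//; try exact: md; try exact: ltW.
2: lra.
rewrite -ge0_integralD//; first last.
- by apply: emeasurable_funM => //; exact: md.
- by move=> t _; rewrite mule_ge0// lee_fin ltW.
- by apply: emeasurable_funM => //; exact: md.
- by move=> t _; rewrite mule_ge0// lee_fin; lra.
apply: ge0_le_integral => //; try exact: md.
- by move=> t _; rewrite adde_ge0// mule_ge0// lee_fin; lra.
- by apply: emeasurable_funD; apply: emeasurable_funM => //; exact: md.
move=> t /=; rewrite in_itv/= andbT => t0.
have [t1|t1] := ltP t 1; last first.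
  have z (u : R -> \bar R) : (forall x, 0 <= u x <= 1)%E ->
      [set x | t%:E < u x]%E = set0.
    move=> u01; rewrite -subset0 => x /= tu.
    by have := lt_le_trans tu (andP (u01 x)).2; rewrite lte_fin ltNge t1.
  by rewrite (z f)// (z g)// measure0 !mule0 adde0.
have [lf uf] := bl f t sf t0; have [lg ug] := bl g t sg t0.
apply: brunn_minkowski_interval => //; try exact: mt.
- by apply: f1; rewrite t0.
- by apply: g1; rewrite t0.
- exact: cf.
- exact: cg.
- by move=> x y; exact: fgh.
Qed.

(** The weighted inequality of the arithmetic and geometric means is Young's
inequality for the exponents [1 / (1 - l)] and [1 / l]. *)
Lemma powR_amgm (a b l : R) : 0 <= a -> 0 <= b -> 0 < l < 1 ->
  a `^ (1 - l) * b `^ l <= (1 - l) * a + l * b.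
Proof.
move=> a0 b0 /andP[l0 l1]; have l1' : 0 < 1 - l by lra.
have := @conjugate_powR R (a `^ (1 - l)) (b `^ l) (1 - l)^-1 l^-1.
rewrite !powR_ge0 !invr_gt0 l0 l1' !invrK subrK => /(_ isT isT isT isT erefl).
rewrite -!powRrM !divff ?gt_eqF// !powRr1//.
by rewrite mulrC [b * l]mulrC [a * _]mulrC [_ `^ l * _]mulrC.
Qed.

Lemma powR_same (a l : R) : 0 < a -> a `^ (1 - l) * a `^ l = a.
Proof. by move=> a0; rewrite -powRD ?subrK ?powRr1 ?ltW// (gt_eqF a0) implybT. Qed.

Lemma ler_powR_mean (a b c d l : R) : 0 < l < 1 -> 0 <= a <= c -> 0 <= b <= d ->
  a `^ (1 - l) * b `^ l <= c `^ (1 - l) * d `^ l.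
Proof.
move=> /andP[l0 l1] /andP[a0 ac] /andP[b0 bd].
have c0 := le_trans a0 ac; have d0 := le_trans b0 bd.
by apply: ler_pM; rewrite ?powR_ge0// ge0_ler_powR ?nnegrE//; lra.
Qed.

(** Dividing [f] and [g] by their suprema and [h] by the corresponding mean
reduces to the normalized case, which bounds the integral of [h] below by an
arithmetic mean. Stating the conclusion for lower bounds [a] and [b] of the
integrals keeps powers of extended reals out. *)
Lemma prekopa_leindler (f g : R -> R) (h : R -> \bar R) (K M l a b : R) :
  0 < l < 1 ->
  measurable_fun setT f -> measurable_fun setT g -> measurable_fun setT h ->
  (forall x, 0 <= f x <= M) -> (forall x, 0 <= g x <= M) ->
  (forall x, 0 <= h x)%E ->
  (forall t, 0 <= t -> is_interval [set x | t < f x]) ->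
  (forall t, 0 <= t -> is_interval [set x | t < g x]) ->
  (forall x, 0 < f x -> `|x| <= K) -> (forall x, 0 < g x -> `|x| <= K) ->
  (forall x y, 0 < f x -> 0 < g y ->
     ((f x `^ (1 - l) * g y `^ l)%:E <= h ((1 - l) * x + l * y)%R)%E) ->
  0 < a -> 0 < b ->
  (a%:E <= \int[mu]_x (f x)%:E)%E -> (b%:E <= \int[mu]_x (g x)%:E)%E ->
  ((a `^ (1 - l) * b `^ l)%:E <= \int[mu]_x h x)%E.
Proof.
move=> l01 mf mg mh f0M g0M h0 cf cg sf sg fgh a0 b0 af bg.
have /andP[l0 l1] := l01; have l1' : 0 < 1 - l by lra.
have key (u : R -> R) c : (forall x, 0 <= u x <= M) -> 0 < c ->
    (c%:E <= \int[mu]_x (u x)%:E)%E ->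
    [/\ 0 < sup (range u), forall x, u x <= sup (range u) &
        forall t, t < 1 -> exists x, t * sup (range u) < u x].
  move=> u0M c0 cu.
  have hu : has_sup (range u).
    split; first by exists (u 0), 0.
    by exists M => _ [x _ <-]; case/andP: (u0M x).
  have us x : u x <= sup (range u) by apply: ub_le_sup; [exact: hu.2|exists x].
  have s0 : 0 < sup (range u).
    rewrite ltNge; apply/negP => s0; move: cu; apply/negP; rewrite -ltNge.
    rewrite integral0_eq ?lte_fin// => x _; congr EFin; apply/eqP.
    by rewrite eq_le (le_trans (us x) s0)/=; case/andP: (u0M x).
  split=> // t t1.
  have [_ [x _ <-] xs] := @sup_adherent _ _ ((1 - t) * sup (range u)) ltac:(nra) hu.
  by exists x; lra.
have [al0 fal fex] := key f a f0M a0 af.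
have [be0 gbe gex] := key g b g0M b0 bg.
move: (sup (range f)) (sup (range g)) al0 be0 fal gbe fex gex =>
  al be al0 be0 fal gbe fex gex.
clear key.
pose c := al `^ (1 - l) * be `^ l.
have c0 : 0 < c by rewrite mulr_gt0// powR_gt0.
have dv (u : R -> R) s : 0 < s -> (forall x, 0 <= u x <= M) -> (forall x, u x <= s) ->
   forall x, (0 <= (u x / s)%:E <= 1)%E.
  move=> s0 u0 us x; rewrite !lee_fin divr_ge0 ?(ltW s0)//=.
    by rewrite ler_pdivrMr// mul1r us.
  by case/andP: (u0 x).
have mu' (u : R -> R) s : measurable_fun setT u ->
    measurable_fun setT (fun x : R => (u x / s)%:E).
  by move=> mu0; apply/measurable_EFinP; exact: measurable_funM.
have ec : (0 <= c^-1)%R by rewrite invr_ge0 ltW.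
have : ((1 - l)%:E * (\int[mu]_x (f x / al)%:E) + l%:E * (\int[mu]_x (g x / be)%:E)
    <= \int[mu]_x (c^-1%:E * h x))%E.
  apply: (@prekopa_leindler_normalized _ _ _ K l l01 (mu' _ _ mf) (mu' _ _ mg)
    (emeasurable_funM (measurable_cst _) mh) (dv _ _ al0 f0M fal) (dv _ _ be0 g0M gbe)).
  - by move=> x; rewrite mule_ge0.
  - move=> t /andP[t0 t1]; have [x tx] := fex t t1.
  by exists x; rewrite /= lte_fin ltr_pdivlMr.
  - move=> t /andP[t0 t1]; have [x tx] := gex t t1.
  by exists x; rewrite /= lte_fin ltr_pdivlMr.
  - move=> t t0; have := cf (t * al) (mulr_ge0 t0 (ltW al0)).
  by congr is_interval; apply/seteqP; split=> x /=; rewrite lte_fin ltr_pdivlMr.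
  - move=> t t0; have := cg (t * be) (mulr_ge0 t0 (ltW be0)).
  by congr is_interval; apply/seteqP; split=> x /=; rewrite lte_fin ltr_pdivlMr.
  - by move=> x; rewrite lte_fin pmulr_lgt0 ?invr_gt0//; exact: sf.
  - by move=> x; rewrite lte_fin pmulr_lgt0 ?invr_gt0//; exact: sg.
  - move=> t x y t0; rewrite !lte_fin => tf tg.
  have fx0 : 0 < f x by have := le_lt_trans t0 tf; rewrite pmulr_lgt0 ?invr_gt0.
  have gy0 : 0 < g y by have := le_lt_trans t0 tg; rewrite pmulr_lgt0 ?invr_gt0.
  rewrite lte_pdivlMl// (lt_le_trans _ (fgh x y fx0 gy0))// -EFinM lte_fin.
  pose m := Num.min (f x / al) (g y / be).
  have tm : t < m by rewrite lt_min tf.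
  have m0 : 0 < m by exact: le_lt_trans tm.
  apply: (@lt_le_trans _ _ (c * m)); first by rewrite ltr_pM2l.
  rewrite -[X in c * X](powR_same l m0) /c mulrACA -!powRM ?(ltW al0) ?(ltW be0) ?(ltW m0)//.
  apply: ler_powR_mean => //.
    by rewrite mulr_ge0 ?(ltW al0) ?(ltW m0)//= -ler_pdivlMl// mulrC ge_min lexx.
  by rewrite mulr_ge0 ?(ltW be0) ?(ltW m0)//= -ler_pdivlMl// mulrC ge_min lexx orbT.
have sc (u : R -> R) s x : (forall x, 0 <= u x <= M) -> 0 < s ->
    measurable_fun setT u -> (x%:E <= \int[mu]_x (u x)%:E)%E ->
    ((x / s)%:E <= \int[mu]_x (u x / s)%:E)%E.
  move=> u0 s0 mu0 xu; under eq_integral do rewrite mulrC EFinM.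
  rewrite ge0_integralZl_EFin//.
  - by rewrite mulrC EFinM lee_pmul2l// lte_fin invr_gt0.
  - by move=> y _; rewrite lee_fin; case/andP: (u0 y).
  - exact/measurable_EFinP.
  - by rewrite invr_ge0 ltW.
rewrite ge0_integralZl_EFin// lee_pdivlMl// => /(le_trans _); apply.
have /(sc f al a f0M al0 mf) af' := af; have /(sc g be b g0M be0 mg) bg' := bg.
apply: (@le_trans _ _ (c%:E * ((1 - l)%:E * (a / al)%:E + l%:E * (b / be)%:E))%E).
  rewrite -!EFinM lee_fin.
  have -> : a `^ (1 - l) * b `^ l = c * ((a / al) `^ (1 - l) * (b / be) `^ l).
    rewrite /c mulrACA -!powRM ?divr_ge0 ?(ltW al0) ?(ltW be0) ?(ltW a0) ?(ltW b0)//.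
    by rewrite ![_ * (_ / _)]mulrC !divfK// gt_eqF.
  rewrite ler_pM2l//; apply: powR_amgm => //; by rewrite divr_ge0// ltW.
rewrite lee_pmul2l//.
by apply: leeD; rewrite lee_pmul2l//.
Qed.

End prekopa_leindler.

(** * The Brunn-Minkowski inequality for convex sets *)

Section brunn_minkowski.
Variable R : realType.
Local Notation mu := (@lebesgue_measure R).
Local Notation lam := (@lebesgue_tuple R).

Definition mix d (l : R) (t u : d.-tuple R) : d.-tuple R :=
  [tuple (1 - l) * tnth t i + l * tnth u i | i < d].

Lemma mix_cons d (l x y : R) (t u : d.-tuple R) :
  mix l [tuple of x :: t] [tuple of y :: u] =
  [tuple of ((1 - l) * x + l * y) :: mix l t u].
Proof.
apply: eq_from_tnth => i; rewrite tnth_mktuple.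
case: (unliftP ord0 i) => [j ->|->]; last by rewrite !tnth0.
by rewrite !tnthS tnth_mktuple.
Qed.

Definition tconvex d (A : set (d.-tuple R)) :=
  forall t u l, A t -> A u -> 0 < l < 1 -> A (mix l t u).

Definition tbounded d (K : R) (A : set (d.-tuple R)) :=
  forall t i, A t -> `|tnth t i| <= K.

Lemma lebesgue_tuple_bounded d K (A : set (d.-tuple R)) : 0 <= K ->
  measurable A -> tbounded K A -> (lam A <= ((2 * K) ^+ d)%:E)%E.
Proof.
move=> K0 mA bA.
apply: (@le_trans _ _ (lam (box (fun _ : 'I_d => [set` `[- K, K]%R])))).
  apply: subset_measure => //; first exact: measurable_box.
  by move=> t At i /=; rewrite in_itv/= -ler_norml; exact: bA.
rewrite lebesgue_box//.
under eq_bigr => i _.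
  rewrite lebesgue_measure_itv/= lte_fin.
  rewrite (_ : (if _ then _ else _) = (2 * K)%:E); last first.
    by case: ltP => h; rewrite -?EFinD; congr EFin; lra.
  over.
by rewrite prodEFin prodr_const card_ord.
Qed.

Section slices.
Variables (d : nat) (K : R).
Hypothesis K0 : 0 <= K.

Definition slice (A : set (d.+1.-tuple R)) (x : R) : set (d.-tuple R) :=
  [set t : d.-tuple R | A [tuple of x :: t]].

Definition vslice A x : R := fine (lam (slice A x)).

Variable (A : set (d.+1.-tuple R)).
Hypotheses (mA : measurable A) (bA : tbounded K A).

Lemma slice_bounded x : tbounded K (slice A x).
Proof. by move=> t i At; have := bA (lift ord0 i) At; rewrite tnthS. Qed.

Lemma slice_le x : (lam (slice A x) <= ((2 * K) ^+ d)%:E)%E.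
Proof.
by apply: lebesgue_tuple_bounded; [|exact: measurable_consl|exact: slice_bounded].
Qed.

Lemma vsliceK x : (vslice A x)%:E = lam (slice A x).
Proof.
by rewrite fineK// ge0_fin_numE// (le_lt_trans (slice_le x))// ltry.
Qed.

Lemma vslice_bound x : 0 <= vslice A x <= (2 * K) ^+ d.
Proof. by rewrite -!lee_fin vsliceK measure_ge0 slice_le. Qed.

Lemma vslice_support x : 0 < vslice A x -> `|x| <= K.
Proof.
rewrite -lte_fin vsliceK => h; apply/negPn/negP => xK; move: h.
rewrite (_ : slice A x = set0) ?measure0 ?ltxx// -subset0 => t At.
have := bA ord0 At.
by rewrite tnth0 (negbTE xK).
Qed.

Lemma measurable_vslice : measurable_fun setT (vslice A).
Proof.
apply/measurable_EFinP.
rewrite (_ : _ \o _ = fun x => lam (slice A x)); last first.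
  by apply/funext => x /=; rewrite vsliceK.
exact: measurable_section.
Qed.

Lemma slice_convex x : tconvex A -> tconvex (slice A x).
Proof.
move=> cA t u l At Au l01; have := cA _ _ l At Au l01; rewrite mix_cons.
by rewrite (_ : (1 - l) * x + l * x = x)//; ring.
Qed.
End slices.

(** The slices of [C] contain the combinations of the slices of [A] and [B],
so the induction hypothesis is the assumption of the inequality of Prekopa and
Leindler. Applied to three slices of the same convex set, it also shows that
the volume of the slices is quasi-concave. *)
Theorem brunn_minkowski d (K l : R) (A B C : set (d.-tuple R)) (a b : R) :
  0 <= K -> 0 < l < 1 ->
  measurable A -> measurable B -> measurable C ->
  tbounded K A -> tbounded K B -> tconvex A -> tconvex B ->
  (forall t u, A t -> B u -> C (mix l t u)) ->
  0 < a -> 0 < b -> (a%:E <= lam A)%E -> (b%:E <= lam B)%E ->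
  ((a `^ (1 - l) * b `^ l)%:E <= lam C)%E.
Proof.
move=> K0; elim: d l A B C a b => [|d IH] l A B C a b
  l01 mA mB mC bA bB cA cB ABC a0 b0.
  have e1 (X : set (0.-tuple R)) x : 0 < x -> (x%:E <= lam X)%E -> X [tuple] /\ x <= 1.
    move=> x0; rewrite /= diracE; case: (boolP ([tuple] \in X)) => [/set_mem ? /= | _ /=].
      by rewrite lee_fin.
    by rewrite lee_fin leNgt x0.
  move=> /(e1 _ _ a0)[A0 a1] /(e1 _ _ b0)[B0 b1].
  have C0 : C [tuple] by rewrite -(tuple0 (mix l [tuple] [tuple])); exact: ABC.
  rewrite [lam C]/= diracE mem_set//= lee_fin.
  apply: (le_trans (powR_amgm (ltW a0) (ltW b0) l01)).
  by case/andP: l01 => l0 l1; nra.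
move=> aA bB'.
have vi (X : set (d.+1.-tuple R)) t : measurable X -> tbounded K X -> tconvex X -> 0 <= t ->
    is_interval [set x | t < vslice X x].
  move=> mX bX cX t0 x y /= tx ty z /andP[xz zy].
  have [->//|xz'] := eqVneq z x; have [->//|zy'] := eqVneq z y.
  have {}xz : x < z by rewrite lt_neqAle eq_sym xz' xz.
  have {}zy : z < y by rewrite lt_neqAle zy' zy.
  pose s := (z - x) / (y - x).
  have yx0 : 0 < y - x by lra.
  have s01 : 0 < s < 1 by rewrite /s divr_gt0 ?ltr_pdivrMr//=; lra.
  pose m := Num.min (vslice X x) (vslice X y).
  have tm : t < m by rewrite lt_min tx ty.
  have m0 : 0 < m by exact: le_lt_trans tm.
  rewrite (lt_le_trans tm)// -lee_fin (vsliceK K0 mX bX) -[Y in (Y%:E <= _)%E](powR_same s m0).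
  apply: (IH s (slice X x) (slice X y)) => //; try exact: measurable_consl;
    try exact: slice_bounded; try exact: slice_convex.
  - move=> u v Xu Xv; have := cX _ _ s Xu Xv s01; rewrite mix_cons.
    have -> : (1 - s) * x + s * y = x + s * (y - x) by ring.
    by rewrite /s divfK ?gt_eqF// addrC subrK.
  - by rewrite -(vsliceK K0 mX bX) lee_fin ge_min lexx.
  - by rewrite -(vsliceK K0 mX bX) lee_fin ge_min lexx orbT.
apply: (@prekopa_leindler R (vslice A) (vslice B) (fun z => lam (slice C z))
  K ((2 * K) ^+ d) l a b) => //.
- exact: (measurable_vslice K0 mA bA).
- exact: (measurable_vslice K0 mB bB).
- exact: measurable_section.
- exact: (vslice_bound K0 mA bA).
- exact: (vslice_bound K0 mB bB).
- by move=> t t0; exact: vi.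
- by move=> t t0; exact: vi.
- exact: (vslice_support K0 mA bA).
- exact: (vslice_support K0 mB bB).
- move=> x y fx gy; apply: (IH l (slice A x) (slice B y)) => //; try exact: measurable_consl;
    try exact: slice_bounded; try exact: slice_convex.
  + by move=> t u At Bu; rewrite /slice /= -mix_cons; exact: ABC.
  + by rewrite (vsliceK K0 mA bA).
  + by rewrite (vsliceK K0 mB bB).
- rewrite (le_trans aA)//= le_eqVlt; apply/orP; left; apply/eqP.
  by apply: eq_integral => x _; rewrite (vsliceK K0 mA bA).
- rewrite (le_trans bB')//= le_eqVlt; apply/orP; left; apply/eqP.
  by apply: eq_integral => x _; rewrite (vsliceK K0 mB bB).
Qed.
End brunn_minkowski.

(** * Slabs and dilations *)

(** Cauchy's functional equation: a nonnegative solution is monotone, so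
[k * a x] is caught between consecutive multiples of [a 1] for every [k]. *)
Lemma additive_ge0_linear (R : realType) (a : R -> R) :
  (forall x y, 0 <= x -> 0 <= y -> a (x + y) = a x + a y) ->
  (forall x, 0 <= x -> 0 <= a x) -> forall x, 0 <= x -> a x = x * a 1.
Proof.
move=> aD a0 x x0.
have a00 : a 0 = 0 by have := aD 0 0 (lexx 0) (lexx 0); rewrite addr0; lra.
have am y z : 0 <= y -> y <= z -> a y <= a z.
  by move=> y0 yz; rewrite -(subrKC y z) aD ?subr_ge0// lerDl a0// subr_ge0.
have an k y : 0 <= y -> a (k%:R * y) = k%:R * a y.
  move=> y0; elim: k => [|k IH]; first by rewrite !mul0r.
  by rewrite mulrSr mulrDl mul1r aD ?mulr_ge0// IH mulrDl mul1r.
have a10 : 0 <= a 1 by exact: a0.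
have bound k : k%:R * `|a x - x * a 1| <= a 1.
  pose j := Num.truncn (k%:R * x).
  have /andP[jl ju] : j%:R <= k%:R * x < j.+1%:R by apply: truncn_itv; rewrite mulr_ge0.
  have l1 : j%:R * a 1 <= k%:R * a x.
    by rewrite -!an// mulr1; apply: am.
  have l2 : k%:R * a x <= j.+1%:R * a 1.
    by rewrite -!an// mulr1; apply: am; rewrite ?mulr_ge0//; exact: ltW.
  rewrite -[X in X * `|_|]ger0_norm// -normrM mulrBr ler_norml.
  rewrite -natr1 in l2 ju; apply/andP; split; nra.
apply/eqP; rewrite -subr_eq0 -normr_le0 leNgt; apply/negP => e0.
have [k ke] : exists k : nat, a 1 < k%:R * `|a x - x * a 1|.
  exists (Num.truncn (a 1 / `|a x - x * a 1|)).+1.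
  by rewrite -ltr_pdivrMr// truncnS_gt.
by have := bound k; rewrite leNgt ke.
Qed.

Section slab.
Variables (R : realType) (d : nat).
Hypothesis d0 : (0 < d)%N.
Local Notation lam := (@lebesgue_tuple R d).
Local Notation T := (d.-tuple R).

Definition tsum (t : T) : R := \sum_(i < d) tnth t i.

Lemma measurable_tsum : measurable_fun [set: T] tsum.
Proof. by apply: measurable_sum => i; exact: measurable_tnth. Qed.

Definition slab (L : R) : set T := [set t | 0 <= tsum t < L].

Lemma measurable_slab L : measurable (slab L).
Proof.
rewrite (_ : slab L = tsum @^-1` `[0, L[); last first.
  by apply/seteqP; split=> t /=; rewrite in_itv.
by rewrite -[X in measurable X]setTI; exact: measurable_tsum.
Qed.

Lemma tsum_affine a b (t : T) :
  tsum (tmap (fun x => a * x + b) t) = a * tsum t + d%:R * b.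
Proof.
rewrite /tsum; under eq_bigr do rewrite tnth_map.
by rewrite big_split/= -mulr_sumr sumr_const card_ord mulr_natl.
Qed.

(** Slabs over a set invariant under the translations by constants can be cut
and moved, so the measure is additive in the height. *)
Lemma slab_linear (A : set T) : measurable A ->
  (forall b t, A (tmap (fun x => 1 * x + b) t) <-> A t) ->
  (forall L, (lam (A `&` slab L) < +oo)%E) ->
  forall L, 0 <= L -> fine (lam (A `&` slab L)) = L * fine (lam (A `&` slab 1)).
Proof.
move=> mA invA finA.
have mAs L : measurable (A `&` slab L) by apply: measurableI => //; exact: measurable_slab.
apply: (@additive_ge0_linear R (fun L => fine (lam (A `&` slab L)))); last first.
  by move=> L L0; rewrite fine_ge0.
move=> x y x0 y0.
pose X := A `&` [set t | x <= tsum t < x + y].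
have mX : measurable X.
  apply: measurableI => //.
  rewrite (_ : [set _ | _] = tsum @^-1` `[x, x + y[); last first.
    by apply/seteqP; split=> t /=; rewrite in_itv.
  by rewrite -[Y in measurable Y]setTI; exact: measurable_tsum.
have -> : A `&` slab (x + y) = (A `&` slab x) `|` X.
  apply/seteqP; split=> t.
    move=> [At]; rewrite /slab/= => /andP[t0 ty].
    have [tx|xt] := ltP (tsum t) x; first by left; split=> //; rewrite /slab/= t0.
    by right; split=> //=; rewrite xt.
  by move=> [[At]|[At]]; rewrite /slab/= => /andP[h1 h2]; split=> //=; apply/andP; split; lra.
transitivity (fine (lam (A `&` slab x) + lam X)%E).
  congr fine; apply: measureU => //.
  rewrite -subset0 => t [[_]]; rewrite /slab/= => /andP[_ h] [_ /andP[h' _]].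
  by move: h; rewrite ltNge h'.
have -> : lam X = lam (A `&` slab y).
  have := @lebesgue_tuple_affine R d 1 (x / d%:R) X ltr01 mX.
  rewrite invr1 expr1n mul1e => <-; congr (lam _).
  have dn0 : d%:R != 0 :> R by rewrite pnatr_eq0 -lt0n.
  apply/seteqP; split=> t /=; rewrite /X /slab /= tsum_affine mul1r mulrCA divff// mulr1.
    by move=> -[/invA At /andP[h1 h2]]; split=> //; apply/andP; split; lra.
  by move=> -[/invA At /andP[h1 h2]]; split; [exact: At|apply/andP; split; lra].
by rewrite fineD// ge0_fin_numE.
Qed.
End slab.

Lemma measurable_ler_set d (T : measurableType d) (R : realType) (f g : T -> R) :
  measurable_fun setT f -> measurable_fun setT g ->
  measurable [set t | f t <= g t].
Proof.
move=> mf mg; have := measurable_fun_ler mf mg measurableT (Y := [set true]).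
by rewrite setTI; exact.
Qed.

(** * Growth of a set under one of two gauges *)

Section cone_derivative.
Variables (R : realType) (d : nat).
Hypothesis d0 : (0 < d)%N.
Local Notation lam := (@lebesgue_tuple R d).
Local Notation T := (d.-tuple R).
Variables (p q : T -> R) (l : R).
Hypothesis l0 : 0 <= l.
Hypotheses (mp : measurable_fun [set: T] p) (mq : measurable_fun [set: T] q).
Hypothesis paff : forall (a b : R) t, 0 < a -> p (tmap (fun x => a * x + b) t) = a * p t.
Hypothesis qaff : forall (a b : R) t, 0 < a -> q (tmap (fun x => a * x + b) t) = a * q t.
Hypothesis q0 : forall t, 0 <= q t.
Hypothesis finpq : forall r L : R,
  (lam ([set t | (p t <= r)%R /\ (q t <= r)%R] `&` slab L) < +oo)%E.
Hypothesis pq0 : lam ([set t | p t = q t] `&` slab l) = 0%E.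

Local Notation m := d.-1.

(** [sector s r L] is the part of the dilation by [r] of the body
[p <= 1, q <= 1] in the cone [s * q <= p]; [shell r] is the body in which only
the constraint on [p] has been relaxed. *)
Definition sector (s r L : R) : set T :=
  [set t | [/\ p t <= r, q t <= r & s * q t <= p t]] `&` slab L.

Definition shell (r : R) : set T := [set t | p t <= r /\ q t <= 1] `&` slab l.

Let kap (s : R) := fine (lam (sector s 1 l)).

Let mle := @measurable_ler_set _ T R.

Lemma measurable_sector s r L : measurable (sector s r L).
Proof.
apply: measurableI; last exact: measurable_slab.
rewrite (_ : [set t | _] = [set t | p t <= r] `&` [set t | q t <= r]
   `&` [set t | s * q t <= p t]); last first.
  by apply/seteqP; split=> t /=; [case|case=> -[]].
by apply: measurableI; [apply: measurableI|]; apply: mle => //;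
  apply: measurable_funM.
Qed.

Lemma measurable_shell r : measurable (shell r).
Proof.
apply: measurableI; last exact: measurable_slab.
rewrite (_ : [set t | _] = [set t | p t <= r] `&` [set t | q t <= 1]) //.
by apply: measurableI; apply: mle.
Qed.

Let msector := measurable_sector.
Let mshell := measurable_shell.

Let fsector s r L : lam (sector s r L) \is a fin_num.
Proof.
rewrite ge0_fin_numE//; apply: le_lt_trans (finpq r L).
apply: subset_measure => //.
  apply: measurableI; last exact: measurable_slab.
  rewrite (_ : [set t | _] = [set t | p t <= r] `&` [set t | q t <= r]) //.
  by apply: measurableI; apply: mle.
by move=> t [[]].
Qed.

Let fshell r : lam (shell r) \is a fin_num.
Proof.
rewrite ge0_fin_numE//; apply: le_lt_trans (finpq (Num.max r 1) l).
apply: subset_measure => //.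
  apply: measurableI; last exact: measurable_slab.
  rewrite (_ : [set t | _] = [set t | p t <= Num.max r 1] `&` [set t | q t <= Num.max r 1]) //.
  by apply: measurableI; apply: mle.
by move=> t [[pr q1] st]; split=> //; rewrite /= !le_max pr q1 orbT.
Qed.

(** Dilation by [r] also multiplies the height of the slab by [r]; bringing it
back to [l] costs one power of [r]. *)
Lemma sector_scale s r : 0 < r ->
  fine (lam (sector s r l)) = r ^+ m * kap s.
Proof.
move=> r0.
have lin L : 0 <= L -> fine (lam (sector s 1 L)) = L * fine (lam (sector s 1 1)).
  apply: slab_linear => //.
  - rewrite (_ : [set t | _] = [set t | p t <= 1] `&` [set t | q t <= 1]
      `&` [set t | s * q t <= p t]); last first.
      by apply/seteqP; split=> t /=; [case|case=> -[]].
    by apply: measurableI; [apply: measurableI|]; apply: mle => //;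
      apply: measurable_funM.
  - by move=> b t; rewrite /= paff// qaff// !mul1r.
  - by move=> L'; rewrite -ge0_fin_numE//; exact: fsector.
have -> : lam (sector s r l) = ((r ^+ d)%:E * lam (sector s 1 (l / r)))%E.
  have ri : 0 < r^-1 by rewrite invr_gt0.
  have := @lebesgue_tuple_affine R d r^-1 0 _ ri (measurable_sector s 1 (l / r)).
  rewrite invrK => <-; congr (lam _).
  apply/seteqP; split=> t; rewrite /sector /slab /= tsum_affine paff// qaff// mulr0 addr0
     !(mulrC r^-1) !mulrA !ler_pdivrMr// !mul1r ler_pdivlMr// mul0r
     ltr_pM2r// divfK ?gt_eqF//.
rewrite fineM// lin ?divr_ge0 ?(ltW r0)// /kap [in RHS]lin//= -[in r ^+ d](prednK d0) exprSr.
by rewrite -!mulrA; congr (_ * _); rewrite mulrCA mulVKf// gt_eqF.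
Qed.

Let fineD (A B : set T) : measurable A -> measurable B -> A `<=` B ->
  lam B \is a fin_num -> lam A \is a fin_num ->
  (lam (B `\` A) = (fine (lam B) - fine (lam A))%:E)%E.
Proof.
move=> mA mB AB fB fA.
have -> : lam (B `\` A) = (lam B - lam (B `&` A))%E.
  by apply: measureD => //; rewrite ltey_eq fB.
by rewrite (setIidr AB) EFinB !fineK.
Qed.

Let shellS r r' : r <= r' -> shell r `<=` shell r'.
Proof. by move=> rr t [[pr qr] st]; split=> //; split=> //; exact: le_trans rr. Qed.

Let sectorS s r r' : r <= r' -> sector s r l `<=` sector s r' l.
Proof.
by move=> rr t [[pr qr pq] st]; split=> //; split=> //; exact: le_trans rr.
Qed.

Let le_diff s r r' u u' : r <= r' -> u <= u' -> 0 < u ->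
  shell r' `\` shell r `<=` sector s u' l `\` sector s u l ->
  fine (lam (shell r')) - fine (lam (shell r)) <= (u' ^+ m - u ^+ m) * kap s.
Proof.
move=> rr uu u0 sub; rewrite mulrBl -!sector_scale//; last exact: lt_le_trans uu.
rewrite -lee_fin -!fineD//; try exact: shellS; try exact: sectorS.
by apply: subset_measure => //; apply: measurableD.
Qed.

Let ge_diff s r r' u u' : r <= r' -> u <= u' -> 0 < u ->
  sector s u' l `\` sector s u l `<=` shell r' `\` shell r ->
  (u' ^+ m - u ^+ m) * kap s <= fine (lam (shell r')) - fine (lam (shell r)).
Proof.
move=> rr uu u0 sub; rewrite mulrBl -!sector_scale//; last exact: lt_le_trans uu.
rewrite -lee_fin -!fineD//; try exact: shellS; try exact: sectorS.
by apply: subset_measure => //; apply: measurableD.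
Qed.

(** A point gained by relaxing the constraint on [p] from 1 to [r] satisfies
[q <= 1 < p <= r]. So it was gained by the dilation, inside the cone [q <= p];
conversely a point gained by the dilation inside the cone [r * q <= p] has
[q <= 1]. *)
Lemma shell_growth_gt1 r : 1 < r ->
  (r ^+ m - 1) * kap r <= fine (lam (shell r)) - fine (lam (shell 1)) <=
  (r ^+ m - 1) * kap 1.
Proof.
move=> r1; have r1' := ltW r1; have r0 : 0 < r by lra.
rewrite -[X in _ - X](expr1n _ m); apply/andP; split.
  apply: ge_diff => //; move=> t [[[pr qr pq] st] N]; split.
    by split=> //; split=> //; rewrite -(ler_pM2l r0) mulr1; exact: le_trans pr.
  by move=> [[p1 q1] _]; apply: N.
apply: le_diff => //; move=> t [[[pr q1] st] N].
have p1 : 1 < p t by rewrite ltNge; apply/negP => p1; apply: N.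
split; last by move=> [[p1' _ _] _]; move: p1; rewrite ltNge p1'.
by split=> //; split=> //; [exact: le_trans r1'|rewrite mul1r; lra].
Qed.

Lemma shell_growth_lt1 r : 0 < r < 1 ->
  (1 - r ^+ m) * kap 1 <= fine (lam (shell 1)) - fine (lam (shell r)) <=
  (1 - r ^+ m) * kap r.
Proof.
move=> /andP[r0 r1]; have r1' := ltW r1.
rewrite -[X in (X - _)%R](expr1n _ m); apply/andP; split.
  apply: ge_diff => //; move=> t [[[pr qr pq] st] N]; split=> //.
  move=> [[p1 q1] _]; apply: N; split=> //; split=> //.
  by rewrite mul1r in pq; exact: le_trans p1.
apply: le_diff => //; move=> t [[[pr q1] st] N].
have p1 : r < p t by rewrite ltNge; apply/negP => p1; apply: N.
split; last by move=> [[p1' _ _] _]; move: p1; rewrite ltNge p1'.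
by split=> //; split=> //; nra.
Qed.

Let kap_mono s s' : s <= s' -> kap s' <= kap s.
Proof.
move=> ss; rewrite fine_le//; apply: subset_measure => //.
move=> t [[p1 q1 pq] st]; split=> //; split=> //.
by apply: le_trans pq; rewrite ler_wpM2r.
Qed.

(** From the left the cones decrease to the closed cone [q <= p]. *)
Lemma kap_cvg_left e : 0 < e -> exists2 s, s < 1 & kap s <= kap 1 + e.
Proof.
move=> e0; pose u (k : nat) : R := 1 - k.+1%:R^-1.
pose S k := sector (u k) 1 l.
have Scap : \bigcap_k S k = sector 1 1 l.
  apply/seteqP; split=> [t St|t [[p1 q1 pq] st] k _].
    have [[p1 q1 _] st] := St 0 I; split=> //; split=> //; rewrite mul1r.
    rewrite leNgt; apply/negP => pq.
    have [k kq] : exists k : nat, q t < k.+1%:R * (q t - p t).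
      exists (Num.truncn (q t / (q t - p t))).
      by rewrite -ltr_pdivrMr ?subr_gt0// truncnS_gt.
    have [[_ _ h] _] := St k I; move: h; apply/negP; rewrite -ltNge /u mulrBl mul1r.
    by rewrite ltrBrDr -ltrBrDl ltr_pdivrMl//.
  split=> //; split=> //; apply: le_trans pq; rewrite ler_wpM2r// /u.
  by rewrite gerBl invr_ge0.
have Sle i j : (i <= j)%N -> S j `<=` S i.
  move=> ij t [[p1 q1 pq] st]; split=> //; split=> //; apply: le_trans pq.
  by rewrite ler_wpM2r// lerD2l lerN2 lef_pV2 ?posrE// ler_nat.
have : lam \o S @ \oo --> lam (sector 1 1 l).
  rewrite -Scap; apply: nonincreasing_cvg_mu => //.
  - by rewrite ltey_eq; apply/orP; left; exact: fsector.
  - by move=> i; exact: measurable_sector.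
  - by rewrite Scap; exact: measurable_sector.
  - by move=> i j ij; apply/subsetPset; exact: Sle.
rewrite -[X in _ --> X]fineK// => /fine_cvg /cvgrPdist_lt /(_ e e0).
move=> [k _ /(_ k (leqnn k))] /= h.
exists (u k); first by rewrite /u gtrBl invr_gt0.
by move: h; rewrite -/(kap 1) -/(kap (u k)) ltr_norml => /andP[]; lra.
Qed.

(** From the right the cones only exhaust the open cone [q < p]; this is where
the set [p = q] has to be null. *)
Lemma kap_cvg_right e : 0 < e -> exists2 s, 1 < s & kap 1 - e <= kap s.
Proof.
move=> e0; pose u (k : nat) : R := 1 + k.+1%:R^-1.
pose S k := sector (u k) 1 l.
have Sle i j : (i <= j)%N -> S i `<=` S j.
  move=> ij t [[p1 q1 pq] st]; split=> //; split=> //; apply: le_trans pq.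
  by rewrite ler_wpM2r// lerD2l lef_pV2 ?posrE// ler_nat.
have mcup : measurable (\bigcup_k S k).
  by apply: bigcupT_measurable => k; exact: measurable_sector.
have cupS : \bigcup_k S k `<=` sector 1 1 l.
  move=> t [k _ [[p1 q1 pq] st]]; split=> //; split=> //; apply: le_trans pq.
  by rewrite ler_wpM2r// lerDl invr_ge0.
have mpq : measurable ([set t | p t = q t] `&` slab l).
  apply: measurableI; last exact: measurable_slab.
  rewrite (_ : [set t | _] = [set t | p t <= q t] `&` [set t | q t <= p t]).
    by apply: measurableI; apply: mle.
  by apply/seteqP; split=> t /= => [->|[pq qp]] //; apply/eqP; rewrite eq_le pq qp.
have fcup : lam (\bigcup_k S k) \is a fin_num.
  by rewrite ge0_fin_numE// (@le_lt_trans _ _ (lam (sector 1 1 l)))//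
    ?subset_measure// -ge0_fin_numE.
have kapE : lam (\bigcup_k S k) = (kap 1)%:E.
  rewrite fineK//; apply/eqP; rewrite eq_le subset_measure//=.
  rewrite -[leRHS]adde0 -pq0.
  apply: le_trans (measureU2 _ _ _) => //.
  apply: subset_measure => //; first exact: measurableU.
  move=> t [[p1 q1 pq] st]; rewrite mul1r in pq.
  have [pq'|] := eqVneq (p t) (q t); [by right|move=> npq; left].
  have {}pq : q t < p t by rewrite lt_neqAle eq_sym npq.
  have [k kq] : exists k : nat, q t < k.+1%:R * (p t - q t).
    exists (Num.truncn (q t / (p t - q t))).
    by rewrite -ltr_pdivrMr ?subr_gt0// truncnS_gt.
  exists k => //; split=> //; split=> //.
  by rewrite /u mulrDl mul1r -lerBrDl ler_pdivrMl// ltW.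
have : lam \o S @ \oo --> lam (\bigcup_k S k).
  apply: nondecreasing_cvg_mu => //.
    by move=> i; exact: measurable_sector.
  by move=> i j ij; apply/subsetPset; exact: Sle.
rewrite kapE => /fine_cvg /cvgrPdist_lt /(_ e e0) [k _ /(_ k (leqnn k))] /= h.
exists (u k); first by rewrite /u ltrDl invr_gt0.
by move: h; rewrite -/(kap 1) -/(kap (u k)) ltr_norml => /andP[]; lra.
Qed.

Lemma kap_cvg : kap (1 + h) @[h --> 0^'] --> kap 1.
Proof.
apply/cvgrPdist_le => e e0.
have [s s1 ks] := kap_cvg_left e0; have [s' s1' ks'] := kap_cvg_right e0.
near=> h.
have hs : s <= 1 + h.
  have : `|h| < 1 - s by near: h; apply: dnbhs0_lt; lra.
  by rewrite ltr_norml => /andP[]; lra.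
have hs' : 1 + h <= s'.
  have : `|h| < s' - 1 by near: h; apply: dnbhs0_lt; lra.
  by rewrite ltr_norml => /andP[]; lra.
have h1 := kap_mono hs; have h2 := kap_mono hs'.
by rewrite ler_norml; apply/andP; split; lra.
Unshelve. all: by end_near.
Qed.

(** The difference quotient lies between the products of [Q h], the quotient
of [r ^+ m - 1] by [h] at [r = 1 + h], with the measures of the two sectors. *)
Lemma shell_derivative :
  h^-1 * (fine (lam (shell (1 + h))) - fine (lam (shell 1))) @[h --> 0^'] -->
  m%:R * fine (lam (sector 1 1 l)).
Proof.
rewrite -/(kap 1).
pose Q (h : R) := \sum_(i < m) (1 + h) ^+ i.
have Qc : Q h @[h --> 0^'] --> (m%:R : R).
  have : continuous Q.
    apply: continuous_big; first exact: add_continuous.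
    move=> i _ x; apply: (@continuous_comp R R R (fun h : R => 1 + h)
      (fun y : R => y ^+ i) x).
      by apply: cvgD; [exact: cvg_cst|exact: cvg_id].
    exact: exprn_continuous.
  have <- : Q 0 = m%:R.
    rewrite /Q; under eq_bigr do rewrite addr0 expr1n.
    by rewrite sumr_const card_ord.
  move=> /(_ 0) h; apply: cvg_trans h.
  by apply: cvg_app; exact: cvg_within.
pose D (h : R) := Q h * (kap (1 + h) - kap 1).
have Dc : D h @[h --> 0^'] --> (0 : R).
  suff : D h @[h --> 0^'] --> m%:R * (kap 1 - kap 1) by rewrite subrr mulr0.
  by apply: cvgM => //; apply: cvgB; [exact: kap_cvg|exact: cvg_cst].
have DNc : `|D h| @[h --> 0^'] --> (0 : R).
  suff : `|D h| @[h --> 0^'] --> `|0 : R| by rewrite normr0.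
  exact: cvg_norm.
have Qk : Q h * kap 1 @[h --> 0^'] --> m%:R * kap 1.
  by apply: cvgM => //; exact: cvg_cst.
apply: (@squeeze_cvgr _ _ _ _ (fun h => Q h * kap 1 - `|D h|)
   (fun h => Q h * kap 1 + `|D h|)); first last.
- suff : Q h * kap 1 + `|D h| @[h --> 0^'] --> m%:R * kap 1 + 0 by rewrite addr0.
  exact: cvgD.
- suff : Q h * kap 1 - `|D h| @[h --> 0^'] --> m%:R * kap 1 - 0 by rewrite subr0.
  exact: cvgB.
near=> h.
have hn0 : h != 0 by near: h; exact: nbhs_dnbhs_neq.
have : `|h| < 1 by near: h; exact: dnbhs0_lt.
rewrite ltr_norml => /andP[h1 h1'].
have EQ : (1 + h) ^+ m - 1 = h * Q h by rewrite subrX1 addrC addKr.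
have D1 : D h <= `|D h| by exact: ler_norm.
have D2 : - D h <= `|D h| by rewrite -normrN ler_norm.
have D3 : 0 <= `|D h| by [].
have [hp|hn] := ltP 0 h.
  have := @shell_growth_gt1 (1 + h) ltac:(lra); rewrite EQ.
  rewrite -!mulrA -!(ler_pdivlMl _ _ hp) -!(ler_pdivrMl _ _ hp).
  move=> /andP[l1 l2]; apply/andP; split; rewrite /D in D1 D2 *; lra.
have {}hn : 0 < - h by rewrite oppr_gt0 lt_neqAle hn0.
have := @shell_growth_lt1 (1 + h) ltac:(lra).
rewrite (_ : 1 - _ = - h * Q h); last by rewrite mulNr -EQ opprB.
rewrite -!mulrA -!(ler_pdivlMl _ _ hn) -!(ler_pdivrMl _ _ hn) invrN mulNr -mulrN opprB.
move=> /andP[l1 l2]; apply/andP; split; rewrite /D in D1 D2 *; lra.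
Unshelve. all: by end_near.
Qed.
End cone_derivative.

(** * Linear forms on functions on a finite set *)

Section functions_on_finType.
Variables (R : realType) (V : finType).
Local Notation T := (#|V|.-tuple R).
Local Notation lam := (@lebesgue_tuple R #|V|).

Definition tfun (t : T) : V -> R := fun v => tnth t (enum_rank v).

Definition linform (f : (V -> R) -> R) :=
  exists c : V -> R, forall x, f x = \sum_v c v * x v.

Lemma linform_eval u : linform (fun x => x u).
Proof.
exists (fun v => (v == u)%:R) => x.
by rewrite (bigD1 u)//= eqxx mul1r big1 ?addr0// => v /negPf ->; rewrite mul0r.
Qed.

Lemma linformD f g : linform f -> linform g -> linform (fun x => f x + g x).
Proof.
move=> [a fa] [b gb]; exists (fun v => a v + b v) => x.
by rewrite fa gb -big_split/=; apply: eq_bigr => v _; rewrite mulrDl.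
Qed.

Lemma linformZ k f : linform f -> linform (fun x => f x * k).
Proof.
move=> [a fa]; exists (fun v => a v * k) => x.
by rewrite fa mulr_suml; apply: eq_bigr => v _; rewrite mulrAC.
Qed.

Lemma linformN f : linform f -> linform (fun x => - f x).
Proof.
move=> /(linformZ (-1)) [a fa]; exists a => x; by rewrite -fa mulrN1.
Qed.

Lemma linformB f g : linform f -> linform g -> linform (fun x => f x - g x).
Proof. by move=> lf lg; apply: linformD => //; exact: linformN. Qed.

Lemma linform_sum : linform (fun x => \sum_v x v).
Proof. by exists (fun=> 1) => x; apply: eq_bigr => v _; rewrite mul1r. Qed.

Lemma linform_tuple f : linform f -> exists c : 'I_#|V| -> R,
  forall t, f (tfun t) = \sum_i c i * tnth t i.
Proof.
move=> [a fa]; exists (fun i => a (enum_val i)) => t.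
rewrite fa (reindex_onto enum_val enum_rank)/=; last by move=> *; exact: enum_rankK.
apply: eq_big => [i|i _]; first by rewrite enum_valK eqxx.
by rewrite /tfun enum_valK.
Qed.

Lemma measurable_linform f : linform f -> measurable_fun setT (f \o tfun).
Proof.
move=> /linform_tuple[c fc]; rewrite (_ : _ \o _ = fun t => \sum_i c i * tnth t i).
  apply: measurable_sum => i; apply: measurable_funM => //; exact: measurable_tnth.
by apply/funext => t /=.
Qed.

Lemma tfun_surj (x : V -> R) : exists t, tfun t = x.
Proof.
exists [tuple x (enum_val i) | i < #|V|]; apply/funext => v.
by rewrite /tfun tnth_mktuple enum_rankK.
Qed.

Lemma lebesgue_linform0 f b : linform f -> (exists x, f x != 0) ->
  lam [set t | f (tfun t) = b] = 0%E.
Proof.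
move=> lf [x fx]; have [c fc] := linform_tuple lf.
rewrite (_ : [set t | _] = [set t | \sum_(i < #|V|) c i * tnth t i = b]); last first.
  by apply/seteqP; split=> t /=; rewrite fc.
apply: lebesgue_hyperplane; apply/existsP; apply: contraNT fx => /existsPn c0.
have [t <-] := tfun_surj x.
by rewrite fc big1// => i _; have := c0 i; rewrite negbK => /eqP ->; rewrite mul0r.
Qed.

Lemma linform_affine f a b t : linform f -> f (fun=> 1) = 0 ->
  f (tfun (tmap (fun x => a * x + b) t)) = a * f (tfun t).
Proof.
move=> [c fc]; rewrite !fc => c0; transitivity
   (a * (\sum_v c v * tfun t v) + b * (\sum_v c v * 1)); last by rewrite c0 mulr0 addr0.
rewrite !mulr_sumr -big_split/=; apply: eq_bigr => v _.
by rewrite /tfun tnth_map; ring.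
Qed.

Lemma linform_mix f l t u : linform f ->
  f (tfun (mix l t u)) = (1 - l) * f (tfun t) + l * f (tfun u).
Proof.
move=> [c fc]; rewrite !fc !mulr_sumr -big_split/=; apply: eq_bigr => v _.
by rewrite /tfun tnth_mktuple; ring.
Qed.

Lemma tsum_tfun t : tsum t = \sum_v tfun t v.
Proof.
rewrite /tsum (reindex_onto enum_rank enum_val)/=; last by move=> *; exact: enum_valK.
by apply: eq_bigl => v; rewrite enum_rankK eqxx.
Qed.

Lemma lebesgue_tuple_reindex (s : V -> V) (A : set (V -> R)) : injective s ->
  measurable [set t : T | A (tfun t)] ->
  lam [set t | A (tfun t \o s)] = lam [set t | A (tfun t)].
Proof.
move=> sI mA; pose f (i : 'I_#|V|) := enum_rank (s (enum_val i)).
have fI : injective f by move=> i j /enum_rank_inj /sI /enum_val_inj.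
rewrite -(lebesgue_tuple_perm (perm fI) mA); congr (lam _).
have E t : tfun (tperm_of (perm fI) t) = tfun t \o s.
  by apply/funext => v; rewrite /tfun tnth_mktuple permE /f enum_rankK.
by apply/seteqP; split=> t /=; rewrite E.
Qed.

Lemma linform_near f : linform f -> exists2 k, 0 <= k &
  forall x y e, (forall v, `|x v - y v| <= e) -> f x <= f y + k * e.
Proof.
move=> [c fc]; exists (\sum_v `|c v|); first by rewrite sumr_ge0.
move=> x y e xy; rewrite !fc mulr_suml -big_split/=; apply: ler_sum => v _.
rewrite -lerBlDl -mulrBr (le_trans (ler_norm _))// normrM.
by rewrite ler_wpM2l.
Qed.

(** With [k j] the Lipschitz constant of [f j] for the sup norm and [g j] the
slack of [x0], a cube of half-side [1 / (1 + sum k j / g j)] around [x0] fits. *)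
Lemma open_polyhedron_gt0 (I : finType) (f : I -> (V -> R) -> R) (b : I -> R) x0
    (A : set T) : measurable A ->
  (forall j, linform (f j)) -> (forall j, f j x0 < b j) ->
  (forall t, (forall j, f j (tfun t) < b j) -> A t) -> (0 < lam A)%E.
Proof.
move=> mA lf fb fA.
have /choice[k kP] : forall j, exists k, 0 <= k /\
    forall x y e, (forall v, `|x v - y v| <= e) -> f j x <= f j y + k * e.
  by move=> j; have [k k0 kP] := linform_near (lf j); exists k.
pose g j := b j - f j x0; have g0 j : 0 < g j by rewrite subr_gt0.
pose M := 1 + \sum_j k j / g j.
have S0 j : 0 <= k j / g j by rewrite divr_ge0 ?(ltW (g0 j))//; exact: (kP j).1.
have M0 : 0 < M by rewrite ltr_pwDl// sumr_ge0.
have [t0 t0E] := tfun_surj x0.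
apply: lt_le_trans (lebesgue_open_box (fun i => tnth t0 i) (_ : 0 < M^-1)) _.
  by rewrite invr_gt0.
apply: subset_measure => //; first exact: measurable_box.
move=> t tb; apply: fA => j.
have le1 : f j (tfun t) <= f j x0 + k j * M^-1.
  apply: (kP j).2 => v; rewrite -t0E /tfun.
  have := tb (enum_rank v); rewrite /= in_itv/= => /andP[h1 h2].
  by rewrite ler_norml; apply/andP; split; lra.
apply: (le_lt_trans le1); rewrite -ltrBrDl -/(g j) ltr_pdivrMr//.
rewrite mulrC -ltr_pdivrMr// /M (bigD1 j)//=.
have : 0 <= \sum_(i | i != j) k i / g i by rewrite sumr_ge0.
by move: (k j / g j) => y; move: (\sum_(i | i != j) _) => z; lra.
Qed.

Lemma bigmax_attained (I : finType) (F : I -> R) :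
  \big[Num.max/0]_i F i = 0 \/ exists i, \big[Num.max/0]_i F i = F i.
Proof.
apply: (big_ind (fun x => x = 0 \/ exists i, x = F i)); first by left.
  by move=> x y hx hy; rewrite /Num.max; case: ifP.
by move=> i _; right; exists i.
Qed.

Lemma bigmax0_le (I : finType) (F : I -> R) r : 0 <= r ->
  \big[Num.max/0]_i F i <= r <-> forall i, F i <= r.
Proof.
move=> r0; split=> [h i|h]; last by apply: bigmax_le => //.
by apply: le_trans h; exact: le_bigmax.
Qed.

Lemma bigmax0_scale (I : finType) (F : I -> R) a : 0 < a ->
  \big[Num.max/0]_i (a * F i) = a * \big[Num.max/0]_i F i.
Proof.
move=> a0; rewrite (big_morph (fun x => a * x) (id1 := 0) (op1 := Num.max))//.
  by move=> x y; rewrite maxr_pMr// ltW.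
by rewrite mulr0.
Qed.

Lemma measurable_bigmax d (U : measurableType d) (I : finType) (F : I -> U -> R) :
  (forall i, measurable_fun setT (F i)) ->
  measurable_fun setT (fun u => \big[Num.max/0]_i F i u).
Proof.
move=> mF; elim: (index_enum I) => [|i s IH].
  by under eq_fun do rewrite big_nil; exact: measurable_cst.
by under eq_fun do rewrite big_cons; exact: measurable_maxr.
Qed.

Lemma lebesgue_fin_union0 (I : finType) (A : I -> set T) (X : set T) :
  measurable X -> (forall i, measurable (A i)) -> (forall i, lam (A i) = 0%E) ->
  (forall t, X t -> exists i, A i t) -> lam X = 0%E.
Proof.
move=> mX mA A0 XA; pose Y := \big[setU/set0]_(i : I) A i.
have [mY Y0] : measurable Y /\ lam Y = 0%E.
  apply: (big_ind (fun Y => measurable Y /\ lam Y = 0%E)); first by rewrite measure0.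
    move=> B C [mB B0] [mC C0]; split; first exact: measurableU.
    apply/eqP; rewrite eq_le measure_ge0 andbT.
    by apply: le_trans (measureU2 _ mB mC) _;
      rewrite [X in (X + _)%E]B0 [X in (_ + X)%E]C0 adde0.
  by move=> i _.
apply/eqP; rewrite eq_le measure_ge0 andbT -Y0.
apply: subset_measure => // t /XA[i At].
by rewrite /Y -bigcup_seq; exists i => //=; rewrite mem_index_enum.
Qed.

End functions_on_finType.

(** * The Hessians on the torus *)

Lemma ord3_ind (P : 'I_3 -> Prop) : P 0 -> P 1 -> P 2 -> forall r, P r.
Proof.
by move=> P0 P1 P2 [[|[|[|//]]] lr]; [move: P0|move: P1|move: P2];
  congr P; apply: val_inj.
Qed.

Section hess_theory.
Variables (R : realType) (n : nat).
Local Notation V := (torus n).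
Implicit Types (f g : V -> R) (v : V).

Lemma hess_0 f v : hess 0 f v = hess0 f v. Proof. by []. Qed.
Lemma hess_1 f v : hess 1 f v = hess1 f v. Proof. by []. Qed.
Lemma hess_2 f v : hess 2 f v = hess2 f v. Proof. by []. Qed.
Definition hess_012 := (hess_0, hess_1, hess_2).

Lemma linform_hess r v : linform (fun f => hess r f v).
Proof.
have E := @linform_eval R V.
case: v => a b; elim/ord3_ind: r; rewrite /hess /tnth/=;
  do ![apply: linformB => //|apply: linformD => //].
Qed.

Lemma hess_const r v c : hess r (fun=> c : R) v = 0.
Proof. by case: v => a b; elim/ord3_ind: r; rewrite hess_012 /=; ring. Qed.

Lemma hessD r f g v : hess r (fun u => f u + g u) v = hess r f v + hess r g v.
Proof. by case: v => a b; elim/ord3_ind: r; rewrite !hess_012 /=; ring. Qed.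

Lemma sum_shift f (c : V) : \sum_v f (v.1 + c.1, v.2 + c.2) = \sum_v f v.
Proof.
rewrite [RHS](reindex_inj (h := fun v : V => (v.1 + c.1, v.2 + c.2) : V))//.
apply: (can_inj (g := fun v : V => (v.1 - c.1, v.2 - c.2) : V)) => -[a b] /=.
by rewrite !addrK.
Qed.

Lemma sum_hess r f : \sum_v hess r f v = 0.
Proof.
have S c d : \sum_v f (v.1 + c, v.2 + d) = \sum_v f v by exact: sum_shift f (c, d).
have S1 c : \sum_v f (v.1 + c, v.2) = \sum_v f v.
  by rewrite -(S c 0); apply: eq_bigr => v _; rewrite addr0.
have S2 d : \sum_v f (v.1, v.2 + d) = \sum_v f v.
  by rewrite -(S 0 d); apply: eq_bigr => v _; rewrite addr0.
have S0 : \sum_v f (v.1, v.2) = \sum_v f v by apply: eq_bigr => -[].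
elim/ord3_ind: r.
- rewrite (eq_bigr (fun v => f (v.1, v.2) + f (v.1 + 2, v.2 + 1)
     - f (v.1 + 1, v.2) - f (v.1 + 1, v.2 + 1))); last by case.
  by rewrite !sumrB big_split/= S0 !S !S1; ring.
- rewrite (eq_bigr (fun v => f (v.1 + 1, v.2) + f (v.1, v.2 + 1)
     - f (v.1, v.2) - f (v.1 + 1, v.2 + 1))); last by case.
  by rewrite !sumrB big_split/= S0 !S !S1 S2; ring.
- rewrite (eq_bigr (fun v => f (v.1, v.2) + f (v.1 + 1, v.2 + 2)
     - f (v.1 + 1, v.2 + 1) - f (v.1, v.2 + 1))); last by case.
  by rewrite !sumrB big_split/= S0 !S !S2; ring.
Qed.

(** Each Hessian has mean zero, so an upper bound entails a lower bound. *)
Lemma hess_lower f r v c : (forall v, hess r f v <= c) -> 0 <= c ->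
  `|hess r f v| <= #|V|%:R * c.
Proof.
move=> fc c0.
have V1 : 1 <= #|V|%:R :> R.
  by rewrite ler1n; apply/card_gt0P; exists v.
rewrite ler_norml (le_trans (fc v)) ?ler_peMl// andbT.
have := sum_hess r f; rewrite (bigD1 v)//= => /eqP.
rewrite addr_eq0 => /eqP ->; rewrite lerN2.
apply: (@le_trans _ _ (\sum_(i | i != v) c)); first exact: ler_sum.
apply: (@le_trans _ _ (\sum_(i : V) c)).
  by rewrite [leRHS](bigD1 v)//= lerDr.
by rewrite sumr_const mulr_natl.
Qed.

Local Notation Z := 'Z_n.

Lemma Zp_walk (u : Z -> R) k a c : 0 <= c ->
  (forall a, `|u (a + 1) - u a| <= c) -> `|u (a + k%:R) - u a| <= k%:R * c.
Proof.
move=> c0 uc; elim: k => [|k IH]; first by rewrite mulr0n addr0 subrr normr0 mul0r.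
have -> : u (a + k.+1%:R) - u a = (u (a + k%:R + 1) - u (a + k%:R)) + (u (a + k%:R) - u a).
  by rewrite [RHS]addrA subrK -natr1 addrA.
rewrite (le_trans (ler_normD _ _))// -natr1 mulrDl mul1r addrC.
exact: lerD.
Qed.

Lemma Zp_osc (u : Z -> R) a a' c : 0 <= c ->
  (forall a, `|u (a + 1) - u a| <= c) -> `|u a' - u a| <= #|Z|%:R * c.
Proof.
move=> c0 uc; pose e : Z := (a' - a)%R.
have -> : a' = a + e%:R by rewrite natr_Zp /e subrKC.
apply: le_trans (Zp_walk _ _ c0 uc) _; rewrite ler_wpM2r// ler_nat card_ord.
exact: ltnW (ltn_ord _).
Qed.

Lemma Zp_mean0_bound (u : Z -> R) a c : 0 <= c -> \sum_a u a = 0 ->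
  (forall a, `|u (a + 1) - u a| <= c) -> `|u a| <= #|Z|%:R * c.
Proof.
move=> c0 u0 uc.
have N0 : 0 < #|Z|%:R :> R by rewrite ltr0n; apply/card_gt0P; exists a.
rewrite -(ler_pM2l N0) -[X in X * `|_|](ger0_norm (ltW N0)) -normrM.
have -> : #|Z|%:R * u a = \sum_a' (u a - u a').
  by rewrite sumrB u0 subr0 sumr_const mulr_natl.
apply: le_trans (ler_norm_sum _ _ _) _.
rewrite [leRHS]mulr_natl -sumr_const; apply: ler_sum => a' _.
exact: Zp_osc.
Qed.

(** Along any line in the first direction the increment [u] of [f] has sum zero,
and [D_0] and [D_1] control how it changes from one point to the next: they
compare [u (a, b)] with [u (a + 1, b + 1)] and with [u (a, b + 1)]. *)
Lemma hess_diff1 f c : 0 <= c ->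
  (forall v, `|hess 0 f v| <= c) -> (forall v, `|hess 1 f v| <= c) ->
  forall a b, `|f (a + 1, b) - f (a, b)| <= #|Z|%:R * (c + c).
Proof.
move=> c0 f0 f1 a b.
apply: (@Zp_mean0_bound (fun a => f (a + 1, b) - f (a, b))).
- exact: addr_ge0.
- rewrite sumrB [X in X - _](_ : _ = \sum_a f (a, b)) ?subrr//.
  by rewrite [RHS](reindex_inj (addIr 1)).
move=> a'; have := f0 (a', b); have := f1 (a' + 1, b).
rewrite !hess_012 /hess0 /hess1 -!addrA (_ : 1 + 1 = 2)//.
move=> h1 h2; apply: le_trans (lerD h2 h1); apply: le_trans (ler_normD _ _).
rewrite le_eqVlt; apply/orP; left; apply/eqP; congr `|_|; ring.
Qed.

(** The reflection of the lattice that exchanges [1] and [omega]. *)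
Definition tswap (v : V) : V := (v.2, v.1).

Lemma tswapK : involutive tswap. Proof. by case. Qed.

Lemma hess_tswap f v :
  [/\ hess 0 (f \o tswap) v = hess 2 f (tswap v),
      hess 1 (f \o tswap) v = hess 1 f (tswap v) &
      hess 2 (f \o tswap) v = hess 0 f (tswap v)].
Proof. by case: v => a b; rewrite !hess_012 /tswap /=; split; ring. Qed.

(** Lemma [hess_diff1] and its mirror image bound the increments of [f] in both
directions, hence its oscillation; the bound on the sum does the rest. *)
Lemma hess_bounded f c L v : 0 <= c -> 0 <= L ->
  (forall r v, hess r f v <= c) -> 0 <= \sum_v f v <= L ->
  `|f v| <= L + 2 * (#|Z|%:R * (#|Z|%:R * (2 * (#|V|%:R * c)))).
Proof.
move=> c0 L0 fc /andP[S0 SL]; pose C := #|V|%:R * c.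
have C0 : 0 <= C by rewrite mulr_ge0.
have hC r u : `|hess r f u| <= C by apply: hess_lower => // u'; exact: fc.
pose D := #|Z|%:R * (C + C).
have D0 : 0 <= D by rewrite mulr_ge0// addr_ge0.
have d1 a b : `|f (a + 1, b) - f (a, b)| <= D by exact: hess_diff1.
have d2 a b : `|f (a, b + 1) - f (a, b)| <= D.
  apply: (@hess_diff1 (f \o tswap)) => // u.
    by have [-> _ _] := hess_tswap f u.
  by have [_ -> _] := hess_tswap f u.
have osc u u' : `|f u - f u'| <= 2 * (#|Z|%:R * D).
  case: u u' => a b [a' b'].
  rewrite (_ : f (a, b) - _ = (f (a, b) - f (a', b)) + (f (a', b) - f (a', b'))); last by ring.
  rewrite mulrDl mul1r; apply: le_trans (ler_normD _ _) _; apply: lerD.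
    exact: (@Zp_osc (fun a => f (a, b))).
  exact: (@Zp_osc (fun b => f (a', b))).
have N0 : 0 < #|V|%:R :> R by rewrite ltr0n; apply/card_gt0P; exists v.
have N1 : 1 <= #|V|%:R :> R by rewrite ler1n; apply/card_gt0P; exists v.
rewrite -(ler_pM2l N0) -[X in X * `|_|](ger0_norm (ltW N0)) -normrM.
have -> : #|V|%:R * f v = \sum_u (f v - f u) + \sum_u f u.
  by rewrite sumrB subrK sumr_const mulr_natl.
apply: le_trans (ler_normD _ _) _; rewrite mulrDr addrC; apply: lerD.
  rewrite ger0_norm// (le_trans SL)// ler_peMl//.
apply: le_trans (ler_norm_sum _ _ _) _.
rewrite [leRHS]mulr_natl -sumr_const; apply: ler_sum => u _.
by rewrite -/C (_ : 2 * C = C + C) -/D; [exact: osc|ring].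
Qed.

End hess_theory.

(** * The volume as the measure of a prism, and its derivative *)

Section volume.
Variables (R : realType) (n : nat).
Local Notation V := (torus n).
Local Notation T := (#|V|.-tuple R).
Local Notation lam := (@lebesgue_tuple R #|V|).
Local Notation height := (Num.sqrt #|V|%:R : R).
Implicit Types (s : 'rV[R]_3) (t : T).

Lemma card_torus_gt0 : (0 < #|V|)%N.
Proof. by apply/card_gt0P; exists (0, 0). Qed.

Lemma cardR_gt0 : 0 < #|V|%:R :> R.
Proof. by rewrite ltr0n card_torus_gt0. Qed.

Lemma height_gt0 : 0 < height.
Proof. by rewrite sqrtr_gt0 cardR_gt0. Qed.

Definition prism s : set T :=
  [set t | (forall v r, hess r (tfun t) v <= s 0 r) /\ 0 <= tsum t <= height].

(** A point [g + h / sqrt N] over the polytope has sum [h * sqrt N], and the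
Hessians do not see the constant. *)
Lemma volumeE s : volume n s = fine (lam (prism s)).
Proof.
rewrite /volume /lebesgue_mean0 /lebesgue_fun; congr (fine (lam _)).
have h0 := height_gt0; have hh : height * height = #|V|%:R.
  by rewrite -expr2 sqr_sqrtr// ltW// cardR_gt0.
have hN : #|V|%:R / height = height by rewrite -[X in X / _]hh mulfK// gt_eqF.
apply/seteqP; split=> t /=.
  move=> [g [g0 gs] [h]]; rewrite in_itv/= => /andP[h0' h1] E.
  have {}E : tfun t = fun v => g v + h / height by rewrite E.
  split.
    by move=> v r; rewrite E (hessD r g (fun=> h / height)) hess_const addr0.
  have -> : tsum t = h * height.
    by rewrite tsum_tfun E big_split/= g0 add0r sumr_const -[LHS]mulr_natl mulrCA hN.
  by rewrite mulr_ge0 ?(ltW h0)//= ler_piMl// ltW.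
move=> [ts /andP[s0 s1]].
exists (fun v => tfun t v - tsum t / #|V|%:R).
  split.
    rewrite sumrB -tsum_tfun sumr_const -[X in _ - X]mulr_natl mulrC divfK ?subrr//.
    by rewrite gt_eqF// cardR_gt0.
  by move=> v r; rewrite (hessD r (tfun t) (fun=> - (tsum t / #|V|%:R))) hess_const addr0.
exists (tsum t / height).
  by rewrite in_itv/= divr_ge0 ?(ltW h0)//= ler_pdivrMr// mul1r.
apply/funext => v; rewrite -mulrA -invfM hh subrK.
by [].
Qed.

Lemma measurable_prism s : measurable (prism s).
Proof.
have mt : measurable_fun setT (@tsum R #|V|) by exact: measurable_tsum.
rewrite (_ : prism s =
  \bigcap_(i in [set: V * 'I_3]) [set t | hess i.2 (tfun t) i.1 <= s 0 i.2]
  `&` [set t | 0 <= tsum t] `&` [set t | tsum t <= height]); last first.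
  apply/seteqP; split=> t.
    by move=> [h /andP[h0 h1]]; split=> //; split=> // -[v r] _; exact: h.
  by move=> [[h h0] h1]; split; [move=> v r; exact: (h (v, r) I)|apply/andP].
apply: measurableI; last by apply: measurable_ler_set.
apply: measurableI; last by apply: measurable_ler_set.
apply: fin_bigcap_measurable => // -[v r] _ /=; apply: measurable_ler_set => //.
by apply: (@measurable_linform R V (fun x => hess r x v)); exact: linform_hess.
Qed.

Lemma prism_bounded s : (forall r, 0 < s 0 r) ->
  exists2 K, 0 <= K & tbounded K (prism s).
Proof.
move=> s0; pose c := \sum_r s 0 r.
have c0 : 0 <= c by apply: sumr_ge0 => r _; exact: ltW.
have sc r : s 0 r <= c.
  by rewrite /c (bigD1 r)//= lerDl sumr_ge0// => i _; exact: ltW.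
have h0 := ltW height_gt0.
eexists; last first.
  move=> t i [ht st]; have := @hess_bounded R n (tfun t) c height (enum_val i) c0 h0.
  rewrite /tfun enum_valK; apply; first by move=> r v; exact: le_trans (sc r).
  by rewrite -tsum_tfun.
by rewrite addr_ge0// !mulr_ge0.
Qed.

Lemma prism_convex s s' l t u : 0 <= l <= 1 -> prism s t -> prism s' u ->
  prism ((1 - l) *: s + l *: s') (mix l t u).
Proof.
move=> /andP[l0 l1] [ts /andP[t0 t1]] [us /andP[u0 u1]]; split.
  move=> v r; rewrite (linform_mix _ _ _ (linform_hess R r v)) !mxE.
  by apply: lerD; apply: ler_wpM2l => //; rewrite subr_ge0.
have -> : tsum (mix l t u) = (1 - l) * tsum t + l * tsum u.
  by rewrite !tsum_tfun; exact: (linform_mix l t u (@linform_sum R V)).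
by apply/andP; split; nra.
Qed.

Section derivative.
Variable s : 'rV[R]_3.
Hypothesis s0 : forall r, 0 < s 0 r.

Definition side (b : bool) : 'I_3 := if b then 0 else 1.

(** The gauges of the constraints on [D_2] and on [D_0], [D_1]; starting the
maxima at 0 is harmless for nonnegative bounds. *)
Definition pmax t := \big[Num.max/0]_(v : V) (hess 2 (tfun t) v / s 0 2).
Definition qmax t := \big[Num.max/0]_(i : bool * V)
  (hess (side i.1) (tfun t) i.2 / s 0 (side i.1)).

Let lin r v k : linform (fun x : V -> R => hess r x v / k).
Proof. by apply: linformZ; exact: linform_hess. Qed.

Let mpmax : measurable_fun setT pmax.
Proof.
by apply: measurable_bigmax => v; exact: measurable_linform (lin 2 v (s 0 2)).
Qed.

Let mqmax : measurable_fun setT qmax.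
Proof.
apply: measurable_bigmax => i.
exact: measurable_linform (lin (side i.1) i.2 (s 0 (side i.1))).
Qed.

Let aff r v k a b t : hess r (tfun (tmap (fun x => a * x + b) t)) v / k =
  a * (hess r (tfun t) v / k).
Proof.
by rewrite (linform_affine a b t (linform_hess R r v)) ?hess_const// mulrA.
Qed.

Let pmax_aff (a b : R) t : 0 < a -> pmax (tmap (fun x => a * x + b) t) = a * pmax t.
Proof.
move=> a0; rewrite /pmax -bigmax0_scale//; apply: eq_bigr => v _; exact: aff.
Qed.

Let qmax_aff (a b : R) t : 0 < a -> qmax (tmap (fun x => a * x + b) t) = a * qmax t.
Proof.
move=> a0; rewrite /qmax -bigmax0_scale//; apply: eq_bigr => v _; exact: aff.
Qed.

Let qmax_ge0 t : 0 <= qmax t. Proof. exact: bigmax_ge_id. Qed.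

Let pmax_le t r : 0 <= r -> pmax t <= r <-> forall v, hess 2 (tfun t) v <= r * s 0 2.
Proof.
move=> r0; rewrite bigmax0_le//; split=> h v; have := h v; by rewrite ler_pdivrMr.
Qed.

Let qmax_le t r : 0 <= r -> qmax t <= r <->
  forall b v, hess (side b) (tfun t) v <= r * s 0 (side b).
Proof.
move=> r0; rewrite bigmax0_le//; split=> [h b v|h [b v]].
  by have := h (b, v); rewrite ler_pdivrMr.
by rewrite ler_pdivrMr.
Qed.

Lemma tsum_level0 b : lam [set t | tsum t = b] = 0%E.
Proof.
have := @lebesgue_linform0 R V (fun x => \sum_v x v) b (@linform_sum R V).
rewrite (_ : [set _ | _] = [set t | tsum t = b]); last first.
  by apply/seteqP; split=> t /=; rewrite tsum_tfun.
by apply; exists (fun=> 1); rewrite sumr_const pnatr_eq0 -lt0n card_torus_gt0.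
Qed.

(** Up to the top face, which lies in a hyperplane. *)
Lemma prism_shell (s' : 'rV[R]_3) r : 0 <= r -> s' 0 0 = s 0 0 -> s' 0 1 = s 0 1 ->
  s' 0 2 = r * s 0 2 ->
  lam (prism s') = lam (shell pmax qmax height r).
Proof.
move=> r0 e0 e1 e2.
have sub : shell pmax qmax height r `<=` prism s'.
  move=> t [[/(pmax_le _ r0) hp /(qmax_le _ ler01) hq]]; rewrite /slab/= => /andP[h1 h2].
  split; last by rewrite h1 ltW.
  move=> v; elim/ord3_ind; last by rewrite e2; exact: hp.
    by rewrite e0; have := hq true v; rewrite mul1r.
  by rewrite e1; have := hq false v; rewrite mul1r.
have mprism := measurable_prism s'.
have mshell := measurable_shell height mpmax mqmax r.
have mtop : measurable [set t : T | tsum t = height].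
  have -> : [set t : T | tsum t = height] =
      [set t | tsum t <= height] `&` [set t | height <= tsum t].
    by apply/seteqP; split=> t /= => [->|[h1 h2]] //; apply/eqP; rewrite eq_le h1.
  by apply: measurableI; apply: measurable_ler_set => //; exact: measurable_tsum.
apply/le_anti/andP; split; last exact: subset_measure.
rewrite -[leRHS]adde0 -(tsum_level0 height).
apply: le_trans (measureU2 _ mshell mtop).
apply: subset_measure => //; first exact: measurableU.
move=> t [ts /andP[t0 t1]]; have [tt|tt] := eqVneq (tsum t) height; [by right|left].
split; last by rewrite /slab/= t0 lt_neqAle tt.
split.
  by apply/(pmax_le _ r0) => v; rewrite -e2.
by apply/(qmax_le _ ler01) => -[] v; rewrite mul1r /= -?e0 -?e1.
Qed.

(** Bounded gauges bound the Hessians, and these bound the function. *)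
Lemma pqmax_finite (r L : R) :
  (lam ([set t | (pmax t <= r)%R /\ (qmax t <= r)%R] `&` slab L) < +oo)%E.
Proof.
pose r' := Num.max r 1; have r'0 : 0 <= r' by rewrite le_max ler01 orbT.
have rr : r <= r' by rewrite le_max lexx.
pose L' := Num.max L 0; have L0 : 0 <= L' by rewrite le_max lexx orbT.
pose S := \sum_i s 0 i.
have S0 : 0 <= S by apply: sumr_ge0 => i _; exact: ltW.
have sS i : s 0 i <= S.
  by rewrite /S (bigD1 i)//= lerDl sumr_ge0// => j _; exact: ltW.
have c0 : 0 <= r' * S by rewrite mulr_ge0.
set A := _ `&` _.
have [K K0 KA] : exists2 K, 0 <= K & tbounded K A.
  eexists; last first.
    move=> t i [[tp tq]]; rewrite /slab/= => /andP[t0 tL].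
    have /(pmax_le _ r'0) hp := le_trans tp rr.
    have /(qmax_le _ r'0) hq := le_trans tq rr.
    have := @hess_bounded R n (tfun t) (r' * S) L' (enum_val i) c0 L0.
    rewrite /tfun enum_valK; apply.
      move=> j v; apply: le_trans (_ : r' * s 0 j <= _); last by rewrite ler_wpM2l.
      by elim/ord3_ind: j; [exact: (hq true)|exact: (hq false)|exact: hp].
    by rewrite -tsum_tfun t0/= (le_trans (ltW tL))// le_max lexx.
  by rewrite addr_ge0// !mulr_ge0.
have mA : measurable A.
  apply: measurableI; last exact: measurable_slab.
  rewrite (_ : [set t | _] = [set t | pmax t <= r] `&` [set t | qmax t <= r]) //.
  by apply: measurableI; apply: measurable_ler_set.
exact: le_lt_trans (lebesgue_tuple_bounded K0 mA KA) (ltry _).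
Qed.

Lemma hessZ r k (f : V -> R) v : hess r (fun u => k * f u) v = k * hess r f v.
Proof. by case: v => a b; elim/ord3_ind: r; rewrite !hess_012 /=; ring. Qed.

(** A function of the second coordinate alone: the simplest on which [D_0] and
[D_1] vanish but [D_2] does not. *)
Definition ridge (b0 : 'Z_n) : V -> R := fun v => (v.2 == b0)%:R.

Lemma hess_ridge b0 v : [/\ hess 0 (ridge b0) v = 0, hess 1 (ridge b0) v = 0 &
  hess 2 (ridge b0) v = (v.2 == b0)%:R + (v.2 + 2 == b0)%:R - 2 * (v.2 + 1 == b0)%:R].
Proof. by case: v => a b; rewrite !hess_012 /ridge /=; split; ring. Qed.

Lemma hess2_ridge (v : V) : hess 2 (ridge (v.2 + 1)) v = -2.
Proof.
(* As [1 != 0] in ['Z_n], the neighbours of the crest are not on it. *)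
have [_ _ ->] := hess_ridge (v.2 + 1) v; rewrite eqxx.
rewrite -[X in (X == _)%:R + _]addr0 !(inj_eq (addrI _)) eq_sym oner_eq0.
by rewrite -[1 + 1 == _]subr_eq0 addrK oner_eq0 !add0r mulr1.
Qed.

(** Where the gauges agree, two attained constraints of different types agree,
or else both gauges are 0 and, [D_2] having mean zero, [D_2] vanishes. *)
Lemma pqmax_level0 : lam ([set t | pmax t = qmax t] `&` slab height) = 0%E.
Proof.
have mX : measurable ([set t | pmax t = qmax t] `&` slab height).
  apply: measurableI; last exact: measurable_slab.
  have -> : [set t | pmax t = qmax t] =
      [set t | pmax t <= qmax t] `&` [set t | qmax t <= pmax t].
    by apply/seteqP; split=> t /= => [->|[h1 h2]] //; apply/eqP; rewrite eq_le h1.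
  by apply: measurableI; apply: measurable_ler_set.
pose F (i : V + V * (bool * V)) (x : V -> R) : R := match i with
  | inl v => hess 2 x v / s 0 2
  | inr (v, (b, v')) => hess 2 x v / s 0 2 - hess (side b) x v' / s 0 (side b)
  end.
have lF i : linform (F i).
  by case: i => [v|[v [b v']]]; [exact: lin|apply: linformB; exact: lin].
have nF i : exists x, F i x != 0.
  have s20 : s 0 2 != 0 by rewrite gt_eqF.
  case: i => [v|[v [b v']]]; exists (ridge (v.2 + 1)) => /=; rewrite hess2_ridge.
    by rewrite mulf_neq0 ?invr_eq0// oppr_eq0 pnatr_eq0.
  have [z0 z1 _] := hess_ridge (v.2 + 1) v'.
  have -> : hess (side b) (ridge (v.2 + 1)) v' = 0 by case: (b).
  by rewrite mul0r subr0 mulf_neq0 ?invr_eq0// oppr_eq0 pnatr_eq0.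
apply: (@lebesgue_fin_union0 R V _ (fun i => [set t | F i (tfun t) = 0])) => //.
- move=> i; have mF := measurable_linform (lF i).
  by rewrite -[X in measurable X]setTI; exact: (mF measurableT [set 0]).
- by move=> i; exact: lebesgue_linform0.
move=> t [/= pq _].
have pE : pmax t = 0 \/ exists v, pmax t = hess 2 (tfun t) v / s 0 2.
  exact: bigmax_attained.
have qE : qmax t = 0 \/ exists i : bool * V,
   qmax t = hess (side i.1) (tfun t) i.2 / s 0 (side i.1).
  exact: bigmax_attained.
have [p0|pn0] := eqVneq (pmax t) 0.
  have hle : forall v, hess 2 (tfun t) v <= 0.
    by move=> v; have := (pmax_le t (lexx 0)).1; rewrite p0 lexx mul0r; apply.
  exists (inl (0, 0)) => /=.
  have /hess_lower := hle => /(_ (0, 0) (lexx 0)).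
  by rewrite mulr0 normr_le0 => /eqP ->; rewrite mul0r.
case: pE => [p0|[v pv]]; first by rewrite p0 eqxx in pn0.
case: qE => [q0|[[b v'] qv]]; first by rewrite pq q0 eqxx in pn0.
by exists (inr (v, (b, v'))) => /=; rewrite -pv -qv pq subrr.
Qed.

(** A small ridge, shifted by a constant to the middle of the slab, satisfies
strictly the finitely many linear inequalities that force membership. *)
Lemma sector_gt0 : (0 < lam (sector pmax qmax 1 1 height))%E.
Proof.
(* The ridge over 0 with height [- e] has [D_2 x = s_2 / 4] at [v0], and nowhere
   more; the constraints below force [q <= 1 / 8 <= p]. *)
pose v0 : V := (0, -1).
pose e := s 0 2 / 8.
pose x1 : V -> R := fun v => - e * ridge 0 v.
pose k := (height / 2 - \sum_v x1 v) / #|V|%:R.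
pose x0 : V -> R := fun v => x1 v + k.
have e0 : 0 < e by rewrite divr_gt0.
pose J : finType := ((V * 'I_3) + 'I_3)%type.
pose f (j : J) (x : V -> R) : R := match j with
  | inl (v, r) => hess r x v
  | inr r => tnth [tuple - hess 2 x v0; \sum_v x v; - \sum_v x v] r end.
pose b (j : J) : R := match j with
  | inl (v, r) => tnth [tuple s 0 0 / 8; s 0 1 / 8; s 0 2] r
  | inr r => tnth [tuple - (s 0 2 / 8); height; 0] r end.
apply: (@open_polyhedron_gt0 R V J f b x0).
- exact: measurable_sector.
- case=> [[v r]|r]; first exact: linform_hess.
  elim/ord3_ind: r; rewrite /f /tnth/=.
  + by apply: linformN; exact: linform_hess.
  + exact: linform_sum.
  + by apply: linformN; exact: linform_sum.
- have hx0 r v : hess r x0 v = - e * hess r (ridge 0) v.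
    by rewrite /x0 (hessD r x1 (fun=> k)) hess_const addr0 /x1 hessZ.
  have Sx0 : \sum_v x0 v = height / 2.
    rewrite /x0 big_split/= sumr_const -[X in _ + X]mulr_natl /k mulrC divfK ?subrKC//.
    by rewrite gt_eqF// cardR_gt0.
  have h0 := height_gt0.
  case=> [[v r]|r].
    have [z0 z1 z2] := hess_ridge 0 v; rewrite /f hx0.
    elim/ord3_ind: r; rewrite /b /tnth/= ?z0 ?z1 ?z2 ?mulr0 ?divr_gt0//.
    rewrite mulNr -mulrN opprB; apply: (@le_lt_trans _ _ (e * 2)).
      rewrite ler_pM2l//.
      have B (i : bool) : 0 <= (i%:R : R) <= 1 by case: i; rewrite ler01 lexx.
      move: (B (v.2 + 1 == 0)) (B (v.2 == 0)) (B (v.2 + 2 == 0)).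
      by move: (v.2 + 1 == 0)%:R (v.2 == 0)%:R (v.2 + 2 == 0)%:R => x y z; lra.
    by rewrite /e; have := s0 2; lra.
  elim/ord3_ind: r; rewrite /f /b /tnth/= ?Sx0; try lra.
  rewrite hx0; have := hess2_ridge v0; rewrite /v0 /= addNr => ->.
  by rewrite /e; have := s0 2; lra.
- move=> t h.
  have p18 : 8^-1 <= pmax t.
    rewrite leNgt; apply/negP => /ltW /(pmax_le t (_ : 0 <= 8^-1)).1.
    rewrite invr_ge0 ler0n => /(_ isT v0); have := h (inr 0); rewrite /f /b /tnth/=; lra.
  have q18 : qmax t <= 8^-1.
    apply/(qmax_le _ (_ : 0 <= 8^-1)); first by rewrite invr_ge0.
    by move=> [] v; [have := h (inl (v, 0))|have := h (inl (v, 1))];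
      rewrite /f /b /tnth/= /side => /ltW; rewrite mulrC.
  have p1 : pmax t <= 1.
    apply/(pmax_le _ ler01) => v; rewrite mul1r.
    by have := h (inl (v, 2)); rewrite /f /b /tnth/= => /ltW.
  split.
    by split=> //=; [lra|rewrite mul1r; exact: le_trans p18].
  have := h (inr 1); have := h (inr 2); rewrite /f /b /slab /tnth/= tsum_tfun.
  by move=> h1 ->; rewrite andbT; lra.
Qed.

(** Substitute [h / s_2] for [h] in [shell_derivative]. *)
Lemma volume_derivative2 : exists2 D : R, 0 < D &
  h^-1 * (volume n (s + h *: delta_mx 0 2) - volume n s) @[h --> 0^'] --> D.
Proof.
have d0 := card_torus_gt0.
have H := @shell_derivative R #|V| d0 pmax qmax height (ltW height_gt0) mpmax mqmax
  pmax_aff qmax_aff qmax_ge0 pqmax_finite pqmax_level0.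
pose D := #|V|.-1%:R * fine (lam (sector pmax qmax 1 1 height)).
have V1 : (1 < #|V|)%N by rewrite card_prod card_ord.
have D0 : 0 < D.
  rewrite mulr_gt0//; first by rewrite ltr0n -ltnS prednK.
  rewrite fine_gt0// sector_gt0/=.
  apply: le_lt_trans (pqmax_finite 1 height); apply: subset_measure.
  - exact: measurable_sector.
  - apply: measurableI; last exact: measurable_slab.
    rewrite (_ : [set t | _] = [set t | pmax t <= 1] `&` [set t | qmax t <= 1]) //.
    by apply: measurableI; apply: measurable_ler_set.
  - by move=> t [[]].
exists (D / s 0 2); first by rewrite divr_gt0.
pose F (r : R) := fine (lam (shell pmax qmax height r)).
have volF h : 0 <= 1 + h / s 0 2 -> volume n (s + h *: delta_mx 0 2) = F (1 + h / s 0 2).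
  move=> h0; rewrite volumeE; congr fine; apply: prism_shell => //; rewrite !mxE/=.
  - by rewrite mulr0 addr0.
  - by rewrite mulr0 addr0.
  - by rewrite mulr1 mulrDl mul1r divfK// gt_eqF.
have vol0 : volume n s = F 1.
  have := volF 0; rewrite scale0r addr0 mul0r addr0; apply; exact: ler01.
have Hc : (h / s 0 2)^-1 * (F (1 + h / s 0 2) - F 1) @[h --> 0^'] --> D.
  apply/cvgrPdist_lt => e e0; have /cvgrPdist_lt /(_ e e0) [r /= r0 hr] := H.
  exists (r * s 0 2); first by rewrite /= mulr_gt0.
  move=> h /= hh hn0; apply: hr => /=; last by rewrite mulf_neq0// invr_eq0 gt_eqF.
  move: hh; rewrite !sub0r !normrN normrM => hh.
  by rewrite [X in _ * X]gtr0_norm ?invr_gt0// ltr_pdivrMr.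
have -> : D / s 0 2 = (s 0 2)^-1 * D by rewrite mulrC.
have {}Hc : (s 0 2)^-1 * ((h / s 0 2)^-1 * (F (1 + h / s 0 2) - F 1)) @[h --> 0^']
    --> (s 0 2)^-1 * D.
  by apply: cvgM => //; exact: cvg_cst.
apply: cvg_trans Hc; apply: near_eq_cvg; near=> h.
have hs : `|h| < s 0 2 by near: h; exact: dnbhs0_lt.
rewrite vol0 volF.
  by rewrite mulrA invfM invrK mulrCA mulVf ?mulr1// gt_eqF.
have /ltr_normlP[h1 h2] := hs; rewrite -[X in X + _](@divff _ (s 0 2)) ?gt_eqF//.
by rewrite -mulrDl divr_ge0 ?(ltW (s0 2))//; lra.
Unshelve. all: by end_near.
Qed.
End derivative.
End volume.

(** * Symmetries of the volume and the comparison of derivatives *)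

Section symmetry.
Variables (R : realType) (n : nat).
Local Notation V := (torus n).
Local Notation T := (#|V|.-tuple R).
Local Notation lam := (@lebesgue_tuple R #|V|).
Implicit Types (s : 'rV[R]_3).

Definition pshuffle (tau : 'I_3 -> 'I_3) s : 'rV[R]_3 := \row_r s 0 (tau r).

(** Composition with [sigma] permutes the coordinates, and the constraints up to
the relabelling [tau] of their types. *)
Lemma prism_symmetry (sigma : V -> V) (tau : 'I_3 -> 'I_3) s :
  involutive sigma -> involutive tau ->
  (forall r (f : V -> R) v, exists v', hess r (f \o sigma) v = hess (tau r) f v') ->
  lam (prism (pshuffle tau s)) = lam (prism s).
Proof.
move=> sK tK H; pose A : set (V -> R) := [set f |
   (forall v r, hess r f v <= pshuffle tau s 0 r) /\
   0 <= \sum_v f v <= Num.sqrt #|V|%:R].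
have AE : [set t | A (tfun t)] = prism (pshuffle tau s).
  by apply/seteqP; split=> t /= [h1 h2]; split=> //; move: h2; rewrite tsum_tfun.
rewrite -AE -(lebesgue_tuple_reindex (can_inj sK)); last first.
  by rewrite AE; exact: measurable_prism.
congr (lam _).
have S t : \sum_v (tfun t \o sigma) v = tsum t.
  by rewrite tsum_tfun [RHS](reindex_inj (can_inj sK)).
apply/seteqP; split=> t /= [h1 h2].
  split; last by rewrite -S.
  move=> v r; have [v'] := H r (tfun t \o sigma) v.
  have -> : (tfun t \o sigma) \o sigma = tfun t by apply/funext => u /=; rewrite sK.
  by move=> ->; have := h1 v' (tau r); rewrite mxE tK.
split; last by rewrite S.
by move=> v r; have [v' ->] := H r (tfun t) v; rewrite mxE.
Qed.

Definition tau02 (r : 'I_3) : 'I_3 := tnth [tuple 2; 1; 0] r.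
Definition tau01 (r : 'I_3) : 'I_3 := tnth [tuple 1; 0; 2] r.

Lemma tau02K : involutive tau02.
Proof. by elim/ord3_ind; apply/val_inj. Qed.

Lemma tau01K : involutive tau01.
Proof. by elim/ord3_ind; apply/val_inj. Qed.

Lemma volume_swap02 s : volume n (pshuffle tau02 s) = volume n s.
Proof.
rewrite !volumeE (prism_symmetry (sigma := @tswap n))//.
- exact: tswapK.
- exact: tau02K.
move=> r f v; exists (tswap v); have [h0 h1 h2] := hess_tswap f v.
by elim/ord3_ind: r.
Qed.

(** In the lattice, the reflection in the imaginary axis: it sends [1] to [-1]
and [omega] to [1 + omega]. *)
Definition tflip (v : V) : V := (v.2 - v.1, v.2).

Lemma tflipK : involutive tflip.
Proof. by move=> [a b]; rewrite /tflip /= subKr. Qed.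

Lemma hess_tflip (f : V -> R) v :
  [/\ hess 0 (f \o tflip) v = hess 1 f (v.2 - v.1 - 1, v.2),
      hess 1 (f \o tflip) v = hess 0 f (v.2 - v.1 - 1, v.2) &
      hess 2 (f \o tflip) v = hess 2 f (tflip v)].
Proof.
case: v => a b; rewrite !hess_012 /tflip /=.
have E1 : b + 1 - (a + 2) = b - a - 1 by ring.
have E2 : b + 1 - (a + 1) = b - a by ring.
have E3 : b - (a + 1) = b - a - 1 by ring.
have E4 : b - a - 1 + 1 = b - a by ring.
have E5 : b - a - 1 + 2 = b - a + 1 by ring.
have E6 : b + 1 - a = b - a + 1 by ring.
have E7 : b + 2 - (a + 1) = b - a + 1 by ring.
by rewrite ?(E1, E2, E3, E4, E5, E6, E7); split; ring.
Qed.

Lemma volume_swap01 s : volume n (pshuffle tau01 s) = volume n s.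
Proof.
rewrite !volumeE (prism_symmetry (sigma := tflip))//.
- exact: tflipK.
- exact: tau01K.
move=> r f v; have [h0 h1 h2] := hess_tflip f v.
by elim/ord3_ind: r; eexists; [exact: h0|exact: h1|exact: h2].
Qed.

(** The right-hand vector is the combination of the left-hand one [a] and of its
reflection [b] with weight [l = h / (s_2 - s_0 + h)]; if [s_0 = s_2] it is [b]
itself. *)
Lemma volume_schur s (h : R) : (forall r, 0 < s 0 r) -> s 0 0 <= s 0 2 -> 0 < h ->
  volume n (s + h *: delta_mx 0 2) <= volume n (s + h *: delta_mx 0 0).
Proof.
move=> s0 s02 h0.
set a := s + h *: delta_mx 0 2; set c := s + h *: delta_mx 0 0.
have dE i j : (delta_mx 0 i : 'rV[R]_3) 0 j = (j == i)%:R by rewrite mxE eqxx.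
have aE j : a 0 j = s 0 j + h * (j == 2)%:R by rewrite !mxE eqxx.
have cE j : c 0 j = s 0 j + h * (j == 0)%:R by rewrite !mxE eqxx.
have apos j : 0 < a 0 j by rewrite aE ltr_pwDl// mulr_ge0// ltW.
have cpos j : 0 < c 0 j by rewrite cE ltr_pwDl// mulr_ge0// ltW.
rewrite !volumeE.
have vb : lam (prism (pshuffle tau02 a)) = lam (prism a).
  apply: (prism_symmetry (sigma := @tswap n)); [exact: tswapK|exact: tau02K|].
  move=> r f v; exists (tswap v); have [h0' h1 h2] := hess_tswap f v.
  by elim/ord3_ind: r.
set b := pshuffle tau02 a in vb.
have bE j : b 0 j = a 0 (tau02 j) by rewrite mxE.
have fin s' : (forall r, 0 < s' 0 r) -> lam (prism s') \is a fin_num.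
  move=> s'0; have [K K0 bK] := prism_bounded n s'0.
  rewrite ge0_fin_numE//; apply: le_lt_trans (ltry _).
  exact: lebesgue_tuple_bounded K0 (measurable_prism s') bK.
have bpos j : 0 < b 0 j by rewrite bE.
pose l := h / (s 0 2 - s 0 0 + h).
have den : 0 < s 0 2 - s 0 0 + h by lra.
have mixE : (1 - l) *: a + l *: b = c.
  have ld : l * (s 0 2 - s 0 0 + h) = h by rewrite /l divfK// gt_eqF.
  apply/rowP => j; rewrite mxE [X in X + _]mxE [X in _ + X]mxE bE !aE cE.
  by elim/ord3_ind: j; rewrite /tau02 /tnth /=; nra.
have [e|ne] := eqVneq (s 0 2) (s 0 0).
  have l1 : l = 1 by rewrite /l e subrr add0r divff// gt_eqF.
  by move: mixE; rewrite l1 subrr scale0r add0r scale1r -vb => ->.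
have l01 : 0 < l < 1.
  have : s 0 0 < s 0 2 by rewrite lt_neqAle eq_sym ne.
  by move=> ?; rewrite /l divr_gt0//= ltr_pdivrMr// mul1r; lra.
have [v0|v0] := eqVneq (fine (lam (prism a))) 0; first by rewrite v0 fine_ge0.
have vp : 0 < fine (lam (prism a)) by rewrite lt_neqAle eq_sym v0 fine_ge0.
have [K K0 aK] := prism_bounded n apos; have [K' K'0 bK'] := prism_bounded n bpos.
have l01' : 0 <= l <= 1 by case/andP: l01 => l0 l1; rewrite !ltW.
have conv s' : tconvex (prism s' : set T).
  move=> t u k At Au /andP[k0 k1].
  rewrite [s'](_ : _ = (1 - k) *: s' + k *: s'); last by rewrite -scalerDl subrK scale1r.
  by apply: prism_convex => //; rewrite !ltW.
rewrite -lee_fin (fineK (fin c cpos)) -[X in (X%:E <= _)%E](powR_same l vp).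
apply: (@brunn_minkowski R #|V| (Num.max K K') l (prism a) (prism b) (prism c)) => //.
- by rewrite le_max K0.
- exact: measurable_prism.
- exact: measurable_prism.
- exact: measurable_prism.
- by move=> t i At; rewrite le_max aK.
- by move=> t i At; rewrite le_max bK' ?orbT.
- by move=> t u At Bu; rewrite -mixE; exact: prism_convex.
- by rewrite fineK ?fin.
- by rewrite vb fineK ?fin.
Qed.
End symmetry.

Lemma cone_isosceles (R : realType) (u : 'rV[R]_3) :
  u 0 0 = u 0 1 -> 0 < u 0 2 -> u 0 2 <= u 0 0 -> cone u.
Proof.
move=> u01 u2 u20; have u0 : 0 < u 0 0 by exact: lt_le_trans u20.
have tri (i j k : 'I_3) : i != k -> j != k -> i != j ->
    0 < u 0 i + u 0 j - u 0 k.
  elim/ord3_ind: i; elim/ord3_ind: j; elim/ord3_ind: k;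
    rewrite ?eqxx// -?u01 => _ _ _; lra.
split; first by elim/ord3_ind; rewrite -?u01.
have F_gt0 (sg : 'S_3) : 0 < u 0 (sg 0) + u 0 (sg 1) - u 0 (sg 2).
  by apply: tri; rewrite (inj_eq perm_inj).
by rewrite /=; apply: lt_bigmin => [|sg _]; exact: F_gt0.
Qed.

Theorem lemma7p6 (R : realType) (n : nat) (hn : (1 < n)%N) (e : 'rV[R]_3)
    (he0 : 0 < e 0 0) (he01 : e 0 0 = e 0 1) (he12 : e 0 1 <= e 0 2) :
  cone (\row_(i < 3) w n e i).
Proof.
have e0 r : 0 < e 0 r.
  by elim/ord3_ind: r => //; [rewrite -he01|rewrite (lt_le_trans _ he12)// -he01].
pose q (i : 'I_3) (h : R) := h^-1 * (volume n (e + h *: delta_mx 0 i) - volume n e).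
have wE i (D : R) : q i h @[h --> 0^'] --> D -> w n e i = (n ^ 2)%:R^-1 * D.
  move=> qD; rewrite /w; congr (_ * _); apply: cvg_lim => //.
  apply: cvg_trans qD; apply: near_eq_cvg; near=> h.
  by rewrite /q /= [_ *: _ + _]addrC.
have [D2 D2_gt0 q2] := volume_derivative2 n e0.
have [D0 D0_gt0 q0] : exists2 D : R, 0 < D & q 0 h @[h --> 0^'] --> D.
  have se0 r : 0 < pshuffle tau02 e 0 r by rewrite mxE.
  have [D D_gt0 qD] := volume_derivative2 n se0; exists D => //.
  apply: cvg_trans qD; apply: near_eq_cvg; near=> h.
  rewrite /q; congr (_ * (_ - _)); last exact: volume_swap02.
  rewrite -volume_swap02; congr (volume n _); apply/rowP => j; rewrite !mxE !eqxx/=.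
  by elim/ord3_ind: j.
have q1 : q 1 h @[h --> 0^'] --> D0.
  apply: cvg_trans q0; apply: near_eq_cvg; near=> h.
  rewrite /q; congr (_ * (_ - _)).
  rewrite -volume_swap01; congr (volume n _); apply/rowP => j; rewrite !mxE !eqxx/=.
  by elim/ord3_ind: j; rewrite /tau01 /tnth /= ?he01.
(* Compare the difference quotients for [h > 0]. *)
have D20 : D2 <= D0.
  have e02 : e 0 0 <= e 0 2 by rewrite he01.
  have /cvg_dnbhs_at_right f2 := q2; have /cvg_dnbhs_at_right f0 := q0.
  rewrite -(cvg_lim (@Rhausdorff R) f2) -(cvg_lim (@Rhausdorff R) f0).
  apply: ler_lim; [by apply: cvgP f2|by apply: cvgP f0|].
  near=> h; have h0 : 0 < h by near: h; exact: nbhs_right_gt.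
  by rewrite /q ler_pM2l ?invr_gt0// lerB// volume_schur.
have n0 : 0 < (n ^ 2)%:R^-1 :> R by rewrite invr_gt0 ltr0n expn_gt0 ltnW.
have := wE _ _ q0; have := wE _ _ q1; have := wE _ _ q2.
set u := _^-1; move=> w2 w1 w0.
have p2 : 0 < u * D2 by exact: mulr_gt0.
have p0 : 0 < u * D0 by exact: mulr_gt0.
have p20 : u * D2 <= u * D0 by rewrite ler_pM2l.
by apply: cone_isosceles; rewrite !mxE ?w0 ?w1 ?w2.
Unshelve. all: by end_near.
Qed.
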